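(* Let $R\in\mathcal{R}(d)$ be an R-matrix. The following are equivalent: (a) $E_1(RxR^* )=\tau(x)1$ for all $x\in\mathcal{F}_d^1$. (b) $E_n\big(\varphi^{n-1}(R)\,x\,\varphi^{n-1}(R^* )\big)=E_{n-1}(x)$ for all $n\in\mathbb{N}$, $n\geq 1$, and all $x\in\mathcal{F}_d^n$. (c) $H_R(x)=\tau(x)1$ for all $x\in\mathcal{F}_d^1$. (d) $R$ is ergodic. If $R$ is ergodic, then so are all its cabling powers $R^{(n)}\in\mathcal{R}(d^n)$, $n\in\mathbb{N}$.
   Context: Let $d\ge 2$. $\mathcal{O}_d$ is the Cuntz algebra generated by isometries $S_1,\dots,S_d$ with $S_i^*S_j=\delta_{ij}1$, $\sum_iS_iS_i^*=1$. $\mathcal{F}_d^n=\mathrm{span}\{S_\mu S_\nu^*:|\mu|=|\nu|=n\}\cong M_d^{\otimes n}$ ($\mathcal{F}_d^0=\mathbb{C}1$), and $\mathcal{F}_d$ is the norm closure of $\bigcup_n\mathcal{F}_d^n$. A unitary $u\in\mathcal{O}_d$ defines the unital endomorphism $\lambda_u$ of $\mathcal{O}_d$ with $\lambda_u(S_i)=uS_i$. The canonical endomorphism $\varphi(x)=\sum_iS_ixS_i^*$ restricts to the shift $x\mapsto1\otimes x$ on $\mathcal{F}_d\cong M_d\otimes M_d\otimes\cdots$. An R-matrix of dimension $d$ is a unitary $R$ on $\mathbb{C}^d\otimes\mathbb{C}^d$ with $(R\otimes1)(1\otimes R)(R\otimes1)=(1\otimes R)(R\otimes1)(1\otimes R)$;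 via $M_d\otimes M_d\cong\mathcal{F}_d^2$ it is a unitary in $\mathcal{F}_d^2$ with $R\varphi(R)R=\varphi(R)R\varphi(R)$. $\mathcal{R}(d)$ is the set of all these. $\tau$ is the normalized trace on $\mathcal{F}_d$, $E^0(x)=\frac1{2\pi}\int_0^{2\pi}\lambda_{e^{it}1}(x)\,dt$, $\omega=\tau\circ E^0$, $\mathcal{M}=\pi_\omega(\mathcal{O}_d)''$, $\mathcal{N}=\mathcal{N}_d=\pi_\omega(\mathcal{F}_d)''$ ($\pi_\omega$ the faithful GNS representation, suppressed in notation). For unitary $u\in\mathcal{F}_d$, $\lambda_u$ extends to a normal $\omega$-preserving endomorphism of $\mathcal{M}$ leaving $\mathcal{N}$ invariant. $\mathcal{N}^{\lambda_R}=\{x\in\mathcal{N}:\lambda_R(x)=x\}$, similarly $\mathcal{M}^{\lambda_R}$. $R$ is called ergodic if $\mathcal{N}^{\lambda_R}=\mathbb{C}1$ (equivalently, $\mathcal{M}^{\lambda_R}=\mathbb{C}1$). $E_n:\mathcal{N}\to\mathcal{F}_d^n$ is the $\tau$-preserving conditional expectation (so $E_0=\tau(\cdot)1$), and $H_R:\mathcal{N}\to\mathcal{N}^{\lambda_R}$ is the unique $\tau$-preserving conditional expectation. Cabling powers: let $c_n:\mathcal{N}_d\to\mathcal{N}_{d^n}$ be the isomorphism obtained by grouping the tensor factors of $M_d\otimes M_d\otimes\cdots$ into consecutive blocks of length $n$, $M_d^{\otimes n}\cong M_{d^n}$. Then $R^{(n)}:=c_n({}_nR_n)\in\mathcal{F}_{d^n}^2$,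 where ${}_nR:=\varphi^{n-1}(R)\cdots\varphi(R)R$ and ${}_nR_n:={}_nR\cdot\varphi({}_nR)\cdots\varphi^{n-1}({}_nR)\in\mathcal{F}_d^{2n}$; it is an R-matrix of dimension $d^n$. *)

(* Defs.v *)
From HB Require Import structures.
From mathcomp Require Import all_boot all_order all_algebra.
From mathcomp Require Import sesquilinear complex.
From mathcomp Require Import all_classical all_reals all_analysis.

Set Implicit Arguments.
Unset Strict Implicit.
Unset Printing Implicit Defensive.

Import Order.TTheory GRing.Theory Num.Theory.
Import numFieldNormedType.Exports.

Local Open Scope classical_set_scope.
Local Open Scope ring_scope.

(* Operators on a Hilbert space are plain functions H -> H, which form a left
   module under the pointwise operations; boundedness is a predicate. *)

Record hilbert (K : realType) := Hilbert {
  hcarrier :> completeNormedModType K[i];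
  ip : {dot hcarrier for @Num.conj K[i]};
  ip_norm : forall x : hcarrier, ip x x = `|x| ^+ 2 }.

Notation op H := (hcarrier H -> hcarrier H).

Section Operators.
Variables (K : realType) (H : hilbert K).
Local Notation C := K[i].
Local Notation op := (op H).

Definition bounded_op (a : op) : Prop :=
  linear a /\ exists M : C, forall x, `|a x| <= M * `|x|.

Definition is_adjoint (a b : op) : Prop := forall x y, ip H (a x) y = ip H x (b y).

(* The Hilbert space adjoint; it exists for every bounded a and is unique. *)
Definition adj (a : op) : op := xget 0 [set b | is_adjoint a b].

Definition pos_op (a : op) : Prop := forall x, 0 <= ip H (a x) x.

Definition norm_closure (A : set op) : set op :=
  [set a | bounded_op a /\
    forall e : C, 0 < e -> exists2 b, A b & forall x, `|a x - b x| <= e * `|x|].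

Definition Cstar_subalgebra (A : set op) : Prop :=
  [/\ A `<=` bounded_op /\ A idfun,
      forall (c : C) a b, A a -> A b -> A (c *: a + b),
      forall a b, A a -> A b -> A (a \o b),
      forall a, A a -> A (adj a) &
      norm_closure A `<=` A].

Definition commutant (A : set op) : set op :=
  [set b | bounded_op b /\ forall a, A a -> a \o b = b \o a].

Definition vN_generated (A : set op) : set op := commutant (commutant A).

(* Suprema in A of sets of operators, for the order a <= b iff b - a >= 0. *)
Definition is_sup_in (A D : set op) (s : op) : Prop :=
  [/\ A s, forall a, D a -> pos_op (s - a) &
      forall t, A t -> (forall a, D a -> pos_op (t - a)) -> pos_op (t - s)].

Definition directed_sa (A D : set op) : Prop :=
  [/\ D !=set0, forall a, D a -> A a /\ adj a = a &
      forall a b, D a -> D b ->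
        exists c, [/\ D c, pos_op (c - a) & pos_op (c - b)]].

Definition normal_on (A : set op) (f : op -> op) : Prop :=
  forall D s, directed_sa A D -> is_sup_in A D s -> is_sup_in A (f @` D) (f s).

End Operators.

Record star_hom (K : realType) (H H' : hilbert K) (A : set (op H))
    (f : op H -> op H') : Prop := StarHom {
  hom_lin : forall (c : K[i]) a b, A a -> A b -> f (c *: a + b) = c *: f a + f b;
  hom_mul : forall a b, A a -> A b -> f (a \o b) = f a \o f b;
  hom_one : f idfun = idfun;
  hom_adj : forall a, A a -> f (adj a) = adj (f a) }.

Definition word (K : realType) (H : hilbert K) (I : Type) (S : I -> op H)
  (w : seq I) : op H := foldr (fun i a => S i \o a) idfun w.

Section CuntzAlgebra.
Variables (K : realType) (d : nat) (H : hilbert K) (S : 'I_d -> op H).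
Local Notation op := (op H).
Local Notation C := K[i].

Definition Cuntz_relations : Prop :=
  [/\ forall i, bounded_op (S i),
      forall i j, adj (S i) \o S j = if i == j then idfun else 0 &
      \sum_(i < d) (S i \o adj (S i)) = idfun].

Definition Cuntz_algebra : set op := smallest (@Cstar_subalgebra K H) (range S).

Definition UHF_level (n : nat) : set op :=
  [set x | exists A : n.-tuple 'I_d -> n.-tuple 'I_d -> C,
    x = \sum_mu \sum_nu A mu nu *: (word S mu \o adj (word S nu))].

Definition UHF_algebra : set op := norm_closure (\bigcup_n UHF_level n).

(* The normalized trace of the UHF algebra is its unique tracial state. *)
Definition normalized_trace (tr : op -> C) : Prop :=
  let F := UHF_algebra in
  [/\ forall (c : C) x y, F x -> F y -> tr (c *: x + y) = c * tr x + tr y,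
      forall x, F x -> pos_op x -> 0 <= tr x,
      tr idfun = 1 &
      forall x y, F x -> F y -> tr (x \o y) = tr (y \o x)].

(* gauge t is lambda_{exp(it)1}. *)
Definition gauge_action (gauge : K -> op -> op) : Prop :=
  forall t, [/\ forall x, Cuntz_algebra x -> Cuntz_algebra (gauge t x),
    star_hom Cuntz_algebra (gauge t) &
    forall i, gauge t (S i) = (cos t +i* sin t)%C *: S i].

(* E0(x) is the mean of gauge t x over 0 <= t <= 2 pi, as a weak integral. *)
Definition gauge_mean (gauge : K -> op -> op) (E0 : op -> op) : Prop :=
  forall x, Cuntz_algebra x -> UHF_algebra (E0 x) /\
    forall v w, let f t := ip H (gauge t x v) w in
      ip H (E0 x v) w = ((2 * pi)^-1)%:C%C *
        ((\int[lebesgue_measure]_(t in `[0, 2 * pi]) complex.Re (f t)) +i*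
         (\int[lebesgue_measure]_(t in `[0, 2 * pi]) complex.Im (f t)))%C.

(* w = tau o E^0 on the Cuntz algebra. *)
Definition quasifree_state (w : op -> C) : Prop :=
  exists tr gauge E0, [/\ normalized_trace tr, gauge_action gauge,
    gauge_mean gauge E0 & forall x, Cuntz_algebra x -> w x = tr (E0 x)].

End CuntzAlgebra.

(* The GNS representation of omega = tau o E^0.  It is faithful, so that O_d is
   taken to be the C*-algebra of operators generated by its image on the S_i. *)
Record cuntz_gns (K : realType) (d : nat) := CuntzGNS {
  gnsH :> hilbert K;
  cuntzS : 'I_d -> op gnsH;
  cuntzP : Cuntz_relations cuntzS;
  Omega : gnsH;
  Omega_cyclic : closure [set x Omega | x in Cuntz_algebra cuntzS] = setT;
  Omega_state : quasifree_state cuntzS (fun x => ip gnsH (x Omega) Omega) }.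

Arguments cuntzS {K d} c i _.
Arguments Omega {K d} c.

Section Cuntz.
Variables (K : realType) (d : nat) (G : cuntz_gns K d).
Local Notation op := (op G).
Local Notation C := K[i].

Definition omega (x : op) : C := ip G (x (Omega G)) (Omega G).

Definition Fn (n : nat) : set op := UHF_level (cuntzS G) n.
Definition Mvn : set op := vN_generated (Cuntz_algebra (cuntzS G)).
Definition Nvn : set op := vN_generated (UHF_algebra (cuntzS G)).

(* tau, on F_d as well as on N, is the restriction of omega. *)
Definition tau (x : op) : C := omega x.

Definition phi (x : op) : op := \sum_(i < d) (cuntzS G i \o x \o adj (cuntzS G i)).

Definition unitary_in (A : set op) (u : op) : Prop :=
  [/\ A u, adj u \o u = idfun & u \o adj u = idfun].

Definition Rmatrix (R : op) : Prop :=
  unitary_in (Fn 2) R /\ R \o phi R \o R = phi R \o R \o phi R.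

(* lam is the extension to M, denoted by the same letter, of the endomorphism
   lambda_u of O_d. *)
Record lambda_ext (u : op) (lam : op -> op) : Prop := LambdaExt {
  lam_M : forall x, Mvn x -> Mvn (lam x);
  lam_hom : star_hom Mvn lam;
  lam_normal : normal_on Mvn lam;
  lam_gen : forall i, lam (cuntzS G i) = u \o cuntzS G i;
  lam_omega : forall x, Mvn x -> omega (lam x) = omega x;
  lam_N : forall x, Nvn x -> Nvn (lam x) }.

Definition N_fixed (lam : op -> op) : set op := [set x | Nvn x /\ lam x = x].

Definition ergodic (lam : op -> op) : Prop :=
  N_fixed lam = [set x | exists c : C, x = c *: idfun].

(* E is the tau-preserving conditional expectation of Nvn onto B. *)
Record cond_exp (B : set op) (E : op -> op) : Prop := CondExp {
  ce_lin : forall (c : C) x y, Nvn x -> Nvn y -> E (c *: x + y) = c *: E x + E y;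
  ce_range : forall x, Nvn x -> B (E x);
  ce_id : forall b, B b -> E b = b;
  ce_bimod : forall b x b', B b -> Nvn x -> B b' -> E (b \o x \o b') = b \o E x \o b';
  ce_pos : forall x, Nvn x -> pos_op x -> pos_op (E x);
  ce_tau : forall x, Nvn x -> tau (E x) = tau x }.

(* phi^{n-1}(R) ... phi(R) R *)
Definition nR (n : nat) (R : op) : op :=
  \big[comp/idfun]_(k <- rev (iota 0 n)) iter k phi R.

(* nR phi(nR) ... phi^{n-1}(nR) *)
Definition nRn (n : nat) (R : op) : op :=
  \big[comp/idfun]_(k <- iota 0 n) iter k phi (nR n R).

End Cuntz.

Arguments phi {K d} G x _.
Arguments Fn {K d} G n _.
Arguments Mvn {K d} G _.
Arguments Nvn {K d} G _.
Arguments N_fixed {K d} G lam _.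
Arguments cond_exp {K d} G B E.

Lemma card_word (d n : nat) : #|{: n.-tuple 'I_d}| = (d ^ n)%N.
Proof. by rewrite card_tuple card_ord. Qed.

(* The lexicographic identification of the standard bases of (C^d)^{(x)n} and
   C^{d^n}. *)
Definition block (d n : nat) (t : n.-tuple 'I_d) : 'I_(d ^ n) :=
  cast_ord (card_word d n) (enum_rank t).

(* c is the isomorphism c_n : N_d -> N_{d^n} which groups the tensor factors into
   blocks of length n; mu and nu are lists of blocks. *)
Record grouping (K : realType) (d n : nat) (G : cuntz_gns K d)
    (G' : cuntz_gns K (d ^ n)) (c : op G -> op G') : Prop := Grouping {
  grp_bij : set_bij (Nvn G) (Nvn G') c;
  grp_hom : star_hom (Nvn G) c;
  grp_units : forall mu nu : seq (n.-tuple 'I_d), size mu = size nu ->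
    c (word (cuntzS G) (flatten (map val mu))
       \o adj (word (cuntzS G) (flatten (map val nu)))) =
    word (cuntzS G') (map (@block d n) mu)
       \o adj (word (cuntzS G') (map (@block d n) nu)) }.

Arguments grouping {K d n} G G' c.

(* Main.v *)
Require Import Defs.
From mathcomp Require Import all_boot all_order all_algebra.
From mathcomp Require Import sesquilinear complex.
From mathcomp Require Import all_classical all_reals all_analysis.
From mathcomp Require Import ring lra zify.

(** Write [lambda] for the endomorphism of [R]. On level [n] of the tower it is
    conjugation by the unitary [R phi(R) ... phi^(n-1)(R)] ([endo_Fn]), and the
    Yang-Baxter equation says that [lambda] shifts [R] and everything built from
    [R] ([lam_shift]). All conditions are compared with

      [decorrelates R]: omega (y R x adj R) = omega y omega x for [x], [y] in level 1,

    which is condition (a) tested against level 1 ([decorrelates_E1]). Condition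
    (b) follows by splitting off the last tensor factor ([decorrelates_En]), and
    contains (a) as its case [n = 1].

    Decorrelation implies ergodicity, because it gives [E_(n+1) lambda = lambda E_n].
    Hence [E_n(x) = lambda^n(E_0(x))] is scalar for a fixed point [x], for all [n],
    and [x] is the limit of the [E_n(x)]. The argument is carried out for the
    transposes of these maps under the trace pairing ([decorrelates_dual],
    [decorrelates_fixed]). Ergodicity implies (c), as [H_R] preserves the trace.

    From (c) to decorrelation: [H_R(x)] is the mean of the orbit of [x] under
    [lambda] ([mean_ergodic]). For [x] in level 1, [lambda^(k+1)(x)] is the
    conjugate of [R x adj R] by a unitary which commutes with level 1, so that all
    these elements, and then also [H_R(x)], have the same correlations with level
    1 as [R x adj R] ([omega_iter_lam], [HR_decorrelates]).

    For the cabling powers, [lambda^n] acts on the first block as conjugation by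
    the unitary [nRn n R]. The rule [E_n lambda^n = lambda^n E_0] is therefore
    decorrelation for the cabled matrix ([decorrelates_iter],
    [cabling_decorrelates]), and the Yang-Baxter equation for blocks is the
    statement that [lambda^n] shifts [nRn n R] by [n] places ([nRn_ybe]).

    The analysis rests on three facts about the GNS vector. The state is known
    explicitly on words ([omega_munit]) and satisfies a KMS condition; this makes
    right multiplications bounded, so that the vector is cyclic for the commutant
    and separating ([commutant_Omega], [Mvn_separating]). The vectors [x Omega]
    with [x] in [N] lie in the closure of those with [x] in the tower
    ([Nvn_dense]). Bounded limits of vectors [b Omega] with [b] in [N] come from
    operators in [N] ([Nvn_limit]). Adjoints of bounded operators exist by the
    Riesz representation theorem ([riesz]). *)

Set Implicit Arguments.
Unset Strict Implicit.
Unset Printing Implicit Defensive.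
Import Order.TTheory GRing.Theory Num.Theory.
Import numFieldNormedType.Exports.
Local Open Scope classical_set_scope.
Local Open Scope ring_scope.

(** * Hilbert space geometry *)

Section Hilbert.
Variables (K : realType) (H : hilbert K).
Implicit Types (u v w : H) (a c : K[i]).
Local Notation C := K[i].

(** Norms take values in the complex numbers; estimates, infima and square
    comparisons are done on their real part. *)
Definition nm v : K := complex.Re `|v|.

Lemma complex_ge0E (z : C) : 0 <= z -> z = (complex.Re z)%:C%C.
Proof. by case: z => x y; rewrite lecE /= => /andP[/eqP -> _]. Qed.

Lemma nmE v : `|v| = (nm v)%:C%C.
Proof. exact: complex_ge0E. Qed.

Lemma nm_ge0 v : 0 <= nm v.
Proof. by have := normr_ge0 v; rewrite nmE -[0]/(0%:C%C) lecR. Qed.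

Lemma nm0 : nm 0 = 0.
Proof. by rewrite /nm normr0. Qed.

Lemma nm_eq0 v : nm v = 0 -> v = 0.
Proof. by move=> h; apply/eqP; rewrite -normr_eq0 nmE h. Qed.

Lemma nmN v : nm (- v) = nm v.
Proof. by rewrite /nm normrN. Qed.

Lemma nmBC u v : nm (u - v) = nm (v - u).
Proof. by rewrite -nmN opprB. Qed.

Lemma nmD u v : nm (u + v) <= nm u + nm v.
Proof. by rewrite -lecR rmorphD /= -!nmE ler_normD. Qed.

Lemma nmB_trans w u v : nm (u - v) <= nm (u - w) + nm (w - v).
Proof. by apply: le_trans (nmD _ _); rewrite addrA subrK. Qed.

Lemma nmZ a v : nm (a *: v) = complex.Re `|a| * nm v.
Proof.
rewrite /nm normrZ [`|a|]complex_ge0E // nmE -rmorphM //.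
Qed.

Lemma nm_lin_le v u (M : K) : `|v| <= M%:C%C * `|u| <-> nm v <= M * nm u.
Proof. by rewrite !nmE -rmorphM lecR. Qed.

Lemma ipC u v : ip H u v = (ip H v u)^*.
Proof. by rewrite hermC /= expr0 mul1r. Qed.

Lemma ipl a u v w : ip H (a *: u + v) w = a * ip H u w + ip H v w.
Proof. by rewrite linearDl linearZl_LR. Qed.

Lemma ipr a u v w : ip H w (a *: u + v) = a^* * ip H w u + ip H w v.
Proof. by rewrite linearDr linearZr_LR. Qed.

Lemma ipDl u v w : ip H (u + v) w = ip H u w + ip H v w.
Proof. by rewrite linearDl. Qed.
Lemma ipDr u v w : ip H w (u + v) = ip H w u + ip H w v.
Proof. by rewrite linearDr. Qed.
Lemma ipBl u v w : ip H (u - v) w = ip H u w - ip H v w.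
Proof. by rewrite linearBl. Qed.
Lemma ipBr u v w : ip H w (u - v) = ip H w u - ip H w v.
Proof. by rewrite linearBr. Qed.
Lemma ipZl a u w : ip H (a *: u) w = a * ip H u w.
Proof. by rewrite linearZl_LR. Qed.
Lemma ipZr a u w : ip H w (a *: u) = a^* * ip H w u.
Proof. by rewrite linearZr_LR. Qed.
Lemma ip0l w : ip H 0 w = 0.
Proof. by rewrite linear0l. Qed.
Lemma ip0r w : ip H w 0 = 0.
Proof. by rewrite linear0r. Qed.

Lemma ip_nm v : ip H v v = (nm v ^+ 2)%:C%C.
Proof. by rewrite ip_norm nmE rmorphXn. Qed.

Lemma ip_eq0 v : ip H v v = 0 -> v = 0.
Proof.
by rewrite ip_nm -[0]/(0%:C%C) => -[] /eqP; rewrite sqrf_eq0 => /eqP /nm_eq0.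
Qed.

Lemma ip_ext u v : (forall w, ip H w u = ip H w v) -> u = v.
Proof.
by move=> h; apply/eqP; rewrite -subr_eq0; apply/eqP/ip_eq0; rewrite ipBr h subrr.
Qed.

Lemma Re_conj (z : C) : complex.Re z^* = complex.Re z.
Proof. by case: z. Qed.

Definition rip u v : K := complex.Re (ip H u v).

Lemma ripC u v : rip u v = rip v u.
Proof. by rewrite /rip ipC Re_conj. Qed.

Lemma nmD2 u v : nm (u + v) ^+ 2 = nm u ^+ 2 + nm v ^+ 2 + 2 * rip u v.
Proof.
have h w : nm w ^+ 2 = rip w w by rewrite /rip ip_nm.
rewrite !h /rip ipDl !ipDr !raddfD /= -/(rip u v) -/(rip v u) (ripC v u); ring.
Qed.

Lemma parallelogram u v :
  nm (u + v) ^+ 2 + nm (u - v) ^+ 2 = 2 * nm u ^+ 2 + 2 * nm v ^+ 2.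
Proof.
rewrite !nmD2 nmN /rip -[in ip H u (- v)](scaleN1r v) ipZr rmorphN1 mulN1r raddfN /=.
ring.
Qed.

(** Pythagoras for the component of [u] orthogonal to [v]: the common source of
    the Cauchy-Schwarz inequality and of the orthogonality of minimizers. *)
Lemma ip_sub_proj u v : v != 0 ->
  ip H (u - (ip H u v / ip H v v) *: v) (u - (ip H u v / ip H v v) *: v)
  = ip H u u - `|ip H u v| ^+ 2 / ip H v v.
Proof.
move=> v0; have vv0 : ip H v v != 0 by apply: contra_neq v0 => /ip_eq0.
set t := _ / _.
rewrite ipBl !ipBr !ipZl !ipZr (ipC v u) normCK.
have tv : t * ip H v v = ip H u v by rewrite /t divfK.
rewrite (_ : t * (t^* * _) = t^* * ip H u v); last by rewrite mulrCA tv.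
by rewrite opprB addrA subrK /t [in RHS]mulrAC.
Qed.

Lemma cauchy_schwarz u v : `|ip H u v| <= `|u| * `|v|.
Proof.
have [->|v0] := eqVneq v 0; first by rewrite ip0r normr0 normr0 mulr0.
have vv0 : 0 < ip H v v by rewrite ip_norm exprn_gt0 // normr_gt0.
rewrite -(ler_pXn2r (n := 2)) ?nnegrE ?mulr_ge0 //.
rewrite exprMn -!ip_norm -ler_pdivrMr // -subr_ge0 -ip_sub_proj //.
Qed.

Lemma ip_le u v : complex.Re `|ip H u v| <= nm u * nm v.
Proof.
rewrite -lecR -complex_ge0E // rmorphM /= -!nmE; exact: cauchy_schwarz.
Qed.

Lemma cauchy_lim (u : nat -> H) :
  (forall e : K, 0 < e -> exists N, forall n m, (N <= n)%N -> (N <= m)%N ->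
     nm (u n - u m) < e) ->
  exists l, forall e : K, 0 < e -> exists N, forall n, (N <= n)%N -> nm (u n - l) < e.
Proof.
move=> hu.
have hc : cauchy (u @ \oo).
  apply/cauchy_ballP => e e0.
  have er : e = (complex.Re e)%:C%C by apply: complex_ge0E; apply: ltW.
  have [N hN] := hu (complex.Re e) ltac:(by rewrite -ltcR -er).
  exists (u @` [set n | (N <= n)%N], u @` [set n | (N <= n)%N]).
    by split; exists N => // n /= hn; exists n.
  move=> [x y] /= [[n hn <-] [m hm <-]].
  by rewrite -ball_normE /= nmE er ltcR; apply: hN.
have : cvg (u @ \oo) by exact: cauchy_cvg.
move=> /cvg_ex[l hl]; exists l => e e0.
have : 0 < e%:C%C by rewrite ltcR.
move/cvgrPdist_lt: hl => /[apply] -[N _ hN].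
by exists N => n hn; rewrite nmBC -ltcR -nmE; apply: hN.
Qed.

End Hilbert.

Lemma natSinv_small (K : realType) (d : K) : 0 < d ->
  exists N, forall n, (N <= n)%N -> n.+1%:R^-1 < d.
Proof.
move=> d0; have [N _ hN] := near_infty_natSinv_lt (PosNum d0).
by exists N => n hn; apply: hN.
Qed.

Lemma le_eps (K : realType) (x y : K) : (forall e : K, 0 < e -> x <= y + e) -> x <= y.
Proof. by move=> h; apply/ler_addgt0Pr. Qed.

Lemma le0_small (K : realType) (x M : K) : (forall e : K, 0 < e -> x <= M * e) -> x <= 0.
Proof.
move=> h; apply: le_eps => e e0; have M1 : 0 < `|M| + 1 by rewrite ltr_wpDl.
rewrite add0r; apply: le_trans (h _ (divr_gt0 e0 M1)) _.
by rewrite mulrA ler_pdivrMr // mulrC ler_wpM2l ?(ltW e0) // ler_wpDr // ler_norm.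
Qed.

Section Hilbert2.
Variables (K : realType) (H : hilbert K).
Implicit Types (u v w : H) (c : K[i]).
Local Notation C := K[i].
Local Notation op := (op H).
Implicit Types (a b : op).

Lemma Re_norm_ge0 (z : C) : 0 <= complex.Re `|z|.
Proof. by rewrite -lecR -[X in _ <= X]complex_ge0E //; exact: normr_ge0. Qed.

Lemma Re_normc (x : K) : complex.Re `|x%:C%C| = `|x|.
Proof. by rewrite normc_def /= expr0n /= addr0 sqrtr_sqr. Qed.

Lemma nmZr (x : K) v : nm (x%:C%C *: v) = `|x| * nm v.
Proof. by rewrite nmZ Re_normc. Qed.

Lemma nm_half v : nm (2^-1 *: v) = 2^-1 * nm v.
Proof.
rewrite (_ : 2^-1 = (2^-1 : K)%:C%C); last by rewrite fmorphV rmorph_nat.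
by rewrite nmZr ger0_norm ?invr_ge0.
Qed.

(** By the parallelogram law two almost minimizing elements of a
    midpoint-convex set are close to each other, since their midpoint cannot
    beat the infimum. So all minimizing sequences converge to one vector [v],
    which need not belong to [A]. This yields both the Riesz representation and
    the mean ergodic theorem. *)
Lemma min_norm (A : set H) : A !=set0 ->
  (forall u v, A u -> A v -> A (2^-1 *: (u + v))) ->
  exists (m : K) v, [/\ forall u, A u -> m <= nm u, nm v <= m &
    forall e : K, 0 < e -> exists2 d : K, 0 < d & (exists2 u, A u & nm u < m + d) /\
      forall u, A u -> nm u < m + d -> nm (u - v) < e].
Proof.
move=> [u0 Au0] Amid; pose E := @nm K H @` A.
have hE : has_inf E.
  by split; [exists (nm u0); exists u0|exists 0 => _ [u _ <-]; exact: nm_ge0].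
have Em u : A u -> inf E <= nm u.
  by move=> Au; apply: ge_inf; [exact: hE.2|exists u].
have E0 : 0 <= inf E by apply: lb_le_inf hE.1 _ => _ [u _ <-]; exact: nm_ge0.
have close (d : K) u w : 0 < d -> A u -> A w -> nm u < inf E + d -> nm w < inf E + d ->
    nm (u - w) ^+ 2 <= 4 * (2 * inf E * d + d ^+ 2).
  move=> d0 Au Aw hu hw; have := parallelogram u w; have := Em _ (Amid _ _ Au Aw).
  rewrite nm_half => h1 h2.
  have hu2 : nm u ^+ 2 <= (inf E + d) ^+ 2 by rewrite ler_pXn2r ?nnegrE ?nm_ge0 ?addr_ge0 ?(ltW d0) ?(ltW hu).
  have hw2 : nm w ^+ 2 <= (inf E + d) ^+ 2 by rewrite ler_pXn2r ?nnegrE ?nm_ge0 ?addr_ge0 ?(ltW d0) ?(ltW hw).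
  have h12 : (2 * inf E) ^+ 2 <= nm (u + w) ^+ 2.
    rewrite ler_pXn2r // ?nnegrE ?nm_ge0 ?mulr_ge0 //.
    by rewrite -ler_pdivlMl.
  nra.
have close' (e : K) : 0 < e -> exists2 d : K, 0 < d & forall u w, A u -> A w ->
    nm u < inf E + d -> nm w < inf E + d -> nm (u - w) < e.
  move=> e0; have m1 : 0 < 2 * inf E + 1 by rewrite ltr_wpDl // mulr_ge0.
  (* with d <= 1 the bound of close is at most 4 (2 inf E + 1) d <= e^2 / 2 *)
  exists (Num.min 1 (e ^+ 2 / (8 * (2 * inf E + 1)))).
    by rewrite lt_min ltr01 /= divr_gt0 ?exprn_gt0 // mulr_gt0.
  move=> u w Au Aw; set d := Num.min _ _ => hu hw.
  have d0 : 0 < d by rewrite lt_min ltr01 /= divr_gt0 ?exprn_gt0 // mulr_gt0.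
  have d1 : d <= 1 by rewrite ge_min lexx.
  have d2 : d * (8 * (2 * inf E + 1)) <= e ^+ 2.
    by rewrite -ler_pdivlMr ?mulr_gt0 // ge_min lexx orbT.
  have e2 : 0 < e ^+ 2 by rewrite exprn_gt0.
  rewrite -(ltr_pXn2r (n := 2)) ?nnegrE ?nm_ge0 ?ltW //.
  apply: le_lt_trans (close d u w d0 Au Aw hu hw) _.
  have : d ^+ 2 <= d by rewrite expr2 ger_pMl.
  nra.
have /choice[u hu] : forall n : nat, exists u, A u /\ nm u < inf E + n.+1%:R^-1.
  move=> n; have [|_ [u Au <-] h] := @inf_adherent _ E n.+1%:R^-1 _ hE.
    by rewrite invr_gt0.
  by exists u.
have [|v hv] := @cauchy_lim _ _ u.
  move=> e /close'[d d0 hd]; have [N hN] := natSinv_small d0; exists N => n m hn hm.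
  apply: hd; [exact: (hu n).1|exact: (hu m).1|..].
    by apply: lt_trans (hu n).2 _; rewrite ltrD2l hN.
  by apply: lt_trans (hu m).2 _; rewrite ltrD2l hN.
have half (e : K) : 0 < e -> 0 < e / 2 by move=> e0; rewrite divr_gt0.
exists (inf E), v; split=> //.
  apply: le_eps => e /half e0; have [N hN] := hv _ e0.
  have [N' hN'] := natSinv_small e0.
  have h1 := hN _ (leq_maxl N N'); have h2 := hN' _ (leq_maxr N N'); move: (maxn N N') h1 h2 => n h1 h2.
  have := nmB_trans (u n) v 0; rewrite !subr0 (nmBC v); have := (hu n).2; move: (n.+1%:R^-1) h2 => q; lra.
move=> e /half e0; have [d d0 hd] := close' _ e0; exists d => //; split.
  have [N hN] := natSinv_small d0; exists (u N); first exact: (hu N).1.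
  by apply: lt_trans (hu N).2 _; rewrite ltrD2l hN.
move=> w Aw hw; have [N hN] := hv _ e0; have [N' hN'] := natSinv_small d0.
pose n := maxn N N'; have h1 := hN n (leq_maxl _ _).
have h2 : nm (w - u n) < e / 2.
  apply: hd => //; first exact: (hu n).1.
  by apply: lt_trans (hu n).2 _; rewrite ltrD2l hN' // leq_maxr.
have := nmB_trans (u n) w v; lra.
Qed.

(** The element of least norm in the affine hyperplane [f = 1] is orthogonal to
    the kernel of [f]. *)
Lemma riesz (f : H -> C) (M : K) :
  (forall c u v, f (c *: u + v) = c * f u + f v) ->
  (forall v, `|f v| <= M%:C%C * `|v|) -> exists w, forall v, f v = ip H v w.
Proof.
move=> flin fM; have [f0|] := pselect (forall v, f v = 0).
  by exists 0 => v; rewrite ip0r f0.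
move=> /existsNP[u0 /eqP fu0].
have f0 : f 0 = 0.
  by have := flin (-1) 0 0; rewrite scaler0 addr0 mulN1r addNr.
have fZ c u : f (c *: u) = c * f u by rewrite -[c *: u]addr0 flin f0 addr0.
have fB u v : f (u - v) = f u - f v by rewrite addrC -scaleN1r flin mulN1r addrC.
have fD u v : f (u + v) = f u + f v by rewrite -[u]scale1r flin mul1r scale1r.
have [||m [v [mle vm hv]]] := @min_norm [set u | f u = 1].
- by exists ((f u0)^-1 *: u0); rewrite /= fZ mulVf.
- by move=> u w /= fu fw; rewrite fZ fD fu fw -[1 + 1]/(2%:R) mulVf ?pnatr_eq0.
have fv : f v = 1.
  apply/eqP; rewrite eq_sym -subr_eq0 -normr_eq0 eq_le normr_ge0 andbT.
  rewrite [X in X <= _]complex_ge0E // -[0]/(0%:C%C) lecR.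
  have M1 : 0 < `|M| + 1 by rewrite ltr_wpDl.
  apply: le_eps => e e0; have [d d0 [[u fu hu] hd]] := hv (e / (`|M| + 1)) (divr_gt0 e0 M1).
  rewrite add0r -fu -fB; have := fM (u - v); rewrite [X in X <= _ -> _]complex_ge0E // nmE -rmorphM lecR => h.
  apply: le_trans h _; have h := hd _ fu hu.
  apply: (@le_trans _ _ ((`|M| + 1) * nm (u - v))).
    by rewrite ler_wpM2r ?nm_ge0 // ler_wpDr // ler_norm.
  by rewrite mulrC -ler_pdivlMr // ltW.
have v0 : v != 0.
  by apply/eqP => v0; move: fv; rewrite v0 f0 => /esym/eqP; rewrite oner_eq0.
have orth k : f k = 0 -> ip H k v = 0.
  move=> fk; have [->|k0] := eqVneq k 0; first by rewrite ip0l.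
  have kk : 0 < ip H k k by rewrite ip_norm exprn_gt0 // normr_gt0.
  have := ip_sub_proj v k0; set t := _ / _; set x := v - _ => hx.
  have : nm v <= nm x by apply: le_trans vm _; apply: mle; rewrite /= fB fZ fk mulr0 subr0.
  rewrite -(ler_pXn2r (n := 2)) ?nnegrE ?nm_ge0 // -lecR -!ip_nm hx.
  rewrite lerBrDr gerDl pmulr_lle0 ?invr_gt0 // => h.
  have /eqP : `|ip H v k| ^+ 2 == 0 by rewrite eq_le h exprn_ge0.
  by move/eqP; rewrite sqrf_eq0 normr_eq0 ipC conjC_eq0 => /eqP.
have vv : ip H v v != 0 by apply: contra_neq v0 => /ip_eq0.
exists ((ip H v v)^-1 *: v) => u.
have := orth (u - f u *: v); rewrite fB fZ fv mulr1 subrr => /(_ erefl)/eqP.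
rewrite ipBl ipZl subr_eq0 => /eqP h; rewrite ipZr h.
by rewrite fmorphV /= -ipC mulrC mulfK.
Qed.

Lemma bounded_opP a : bounded_op a <->
  linear a /\ exists2 M : K, 0 <= M & forall x, nm (a x) <= M * nm x.
Proof.
split=> -[la].
  move=> [M hM]; split=> //; exists (complex.Re `|M|); first exact: Re_norm_ge0.
  move=> x; rewrite -nm_lin_le -complex_ge0E //.
  have h := hM x; rewrite -[X in _ * X]normr_id -normrM ger0_norm //.
  exact: le_trans h.
by move=> [M M0 hM]; split=> //; exists M%:C%C => x; rewrite nm_lin_le.
Qed.

(** A bounded linear map given on a dense subspace extends to the whole space.
    The map is given by its graph [Gr], because in the applications both the
    argument and the value are images of an operator at a cyclic vector, and
    well-definedness is part of the bound. The last clause locates the values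
    of [T] in the closure of those of [Gr]. *)
Lemma extend_op (Gr : H -> H -> Prop) (M : K) : 0 <= M ->
  (forall c x y x' y', Gr x y -> Gr x' y' -> Gr (c *: x + x') (c *: y + y')) ->
  (forall x y, Gr x y -> nm y <= M * nm x) ->
  (forall v (e : K), 0 < e -> exists x y, Gr x y /\ nm (v - x) < e) ->
  exists T : op, [/\ bounded_op T, forall x y, Gr x y -> T x = y &
    forall v (e : K), 0 < e -> exists x y, [/\ Gr x y, nm (v - x) < e & nm (T v - y) < e]].
Proof.
move=> M0 Glin GM Gdense.
pose cl v w := forall e : K, 0 < e ->
  exists x y, [/\ Gr x y, nm (v - x) < e & nm (w - y) < e].
have GB x y x' y' : Gr x y -> Gr x' y' -> Gr (x - x') (y - y').
  by move=> h h'; have := Glin (-1) _ _ _ _ h' h; rewrite !scaleN1r addrC (addrC (- y')).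
have half (e : K) : 0 < e -> 0 < e / 2 by move=> e0; rewrite divr_gt0.
have cl_ex v : exists w, cl v w.
  have /choice[xy hxy] : forall n : nat, exists xy : H * H, Gr xy.1 xy.2 /\ nm (v - xy.1) < n.+1%:R^-1.
    by move=> n; have [|x [y h]] := Gdense v n.+1%:R^-1; [rewrite invr_gt0|exists (x, y)].
  have M1 : 0 < 2 * (M + 1) by rewrite mulr_gt0 // ltr_wpDl.
  have [|w hw] := @cauchy_lim _ _ (fun n => (xy n).2).
    move=> e e0; have [N hN] := natSinv_small (divr_gt0 e0 M1); exists N => n m hn hm.
    apply: le_lt_trans (GM _ _ (GB _ _ _ _ (hxy n).1 (hxy m).1)) _.
    have h1 := lt_trans (hxy n).2 (hN _ hn); have h2 := lt_trans (hxy m).2 (hN _ hm).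
    have h3 := nmB_trans v (xy n).1 (xy m).1; rewrite nmBC in h1.
    apply: (@le_lt_trans _ _ ((M + 1) * nm ((xy n).1 - (xy m).1))).
      by rewrite ler_wpM2r ?nm_ge0 // lerDl.
    rewrite mulrC -ltr_pdivlMr ?ltr_wpDl //.
    apply: le_lt_trans h3 _; rewrite (_ : e / (M + 1) = e / (2 * (M + 1)) + e / (2 * (M + 1))).
      exact: ltrD.
    by field; rewrite gt_eqF // ltr_wpDl.
  exists w => e e0; have [N hN] := hw _ e0; have [N' hN'] := natSinv_small e0.
  pose n := maxn N N'; exists (xy n).1, (xy n).2; split; first exact: (hxy n).1.
    by apply: lt_trans (hxy n).2 _; apply: hN'; exact: leq_maxr.
  by rewrite nmBC; apply: hN; exact: leq_maxl.
have cl_bound v w : cl v w -> nm w <= M * nm v.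
  move=> h; apply: le_eps => e e0.
  have M1 : 0 < M + 1 by rewrite ltr_wpDl.
  have [x [y [hxy h1 h2]]] := h _ (divr_gt0 e0 M1).
  have h3 := GM _ _ hxy; have := nmB_trans y w 0; have := nmB_trans v x 0.
  rewrite !subr0 (nmBC x v) => h4 h5.
  have h6 : (e / (M + 1)) * (M + 1) = e by rewrite divfK // gt_eqF.
  set d := e / (M + 1) in h1 h2 h6 *.
  apply: le_trans h5 _.
  have : M * nm x <= M * (nm v + d) by apply: ler_wpM2l => //; lra.
  by rewrite -h6; nra.
have cl_lin c v w v' w' : cl v w -> cl v' w' -> cl (c *: v + v') (c *: w + w').
  move=> h h' e e0; set k := complex.Re `|c|; have k0 : 0 <= k := Re_norm_ge0 _.
  have k1 : 0 < k + 1 by rewrite ltr_wpDl.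
  have [x [y [hxy h1 h2]]] := h _ (half _ (divr_gt0 e0 k1)).
  have [x' [y' [hxy' h1' h2']]] := h' _ (half _ e0).
  have bd (p q p' q' : H) : nm (p - q) < e / (k + 1) / 2 -> nm (p' - q') < e / 2 ->
      nm (c *: p + p' - (c *: q + q')) < e.
    move=> g1 g2; rewrite opprD addrACA -scalerBr.
    apply: le_lt_trans (nmD _ _) _; rewrite nmZ -/k.
    have : k * nm (p - q) <= (k + 1) * nm (p - q).
      by rewrite ler_wpM2r ?nm_ge0 // lerDl.
    have : (k + 1) * nm (p - q) < e / 2.
      by rewrite mulrC -ltr_pdivlMr // mulrAC.
    lra.
  by exists (c *: x + x'), (c *: y + y'); split; [exact: Glin|exact: bd..].
have cl_fun v w w' : cl v w -> cl v w' -> w = w'.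
  move=> h h'; have := cl_bound _ _ (cl_lin (-1) _ _ _ _ h h').
  rewrite !scaleN1r addNr nm0 mulr0 => h0.
  have /nm_eq0 /eqP : nm (- w + w') = 0 by apply/le_anti; rewrite h0 nm_ge0.
  by rewrite addrC subr_eq0 => /eqP.
have [T hT] := choice cl_ex; exists T; split=> //.
  apply/bounded_opP; split; last by exists M => // x; apply: cl_bound.
  by move=> c u v; apply: cl_fun (hT _) _; apply: cl_lin.
by move=> x y hxy; apply: cl_fun (hT _) _ => e e0; exists x, y; rewrite !subrr nm0.
Qed.

End Hilbert2.

(** * Bounded operators, commutants and norm closures *)

Section LinSpan.
Variables (C : nzRingType) (V : lmodType C).
Inductive lspan (A : set V) : V -> Prop :=
| lspan0 : lspan A 0
| lspanP : forall c a b, A a -> lspan A b -> lspan A (c *: a + b).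

Lemma lspan_gen (A : set V) a : A a -> lspan A a.
Proof. by move=> Aa; have := lspanP 1 Aa (lspan0 A); rewrite scale1r addr0. Qed.

Lemma lspan_lin (A : set V) c a b : lspan A a -> lspan A b -> lspan A (c *: a + b).
Proof.
move=> ha hb; elim: ha => [|k x y Ax _ IH]; first by rewrite scaler0 add0r.
by rewrite scalerDr scalerA -addrA; apply: lspanP.
Qed.

Lemma lspanD (A : set V) a b : lspan A a -> lspan A b -> lspan A (a + b).
Proof. by rewrite -{2}[a]scale1r; exact: lspan_lin. Qed.

Lemma lspanZ (A : set V) c a : lspan A a -> lspan A (c *: a).
Proof. by move=> h; rewrite -[_ *: _]addr0; apply: lspan_lin => //; exact: lspan0. Qed.

Lemma lspan_sub (A B : set V) : A `<=` B -> lspan A `<=` lspan B.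
Proof.
by move=> AB x; elim=> [|c a b Aa _ IH]; [exact: lspan0|apply: lspanP => //; exact: AB].
Qed.

Lemma lspan_sum (A : set V) (I : Type) (r : seq I) (P : pred I) (F : I -> V) :
  (forall i, P i -> lspan A (F i)) -> lspan A (\sum_(i <- r | P i) F i).
Proof. by move=> h; apply: big_ind => //; [exact: lspan0|exact: lspanD]. Qed.

End LinSpan.

Section OpAlgebra.
Variables (K : realType) (H : hilbert K).
Implicit Types (u v w : H) (c : K[i]).
Local Notation C := K[i].
Local Notation op := (op H).
Implicit Types (a b : op) (A : set op).

Lemma bopP a : bounded_op a -> forall c u v, a (c *: u + v) = c *: a u + a v.
Proof. by case. Qed.
Lemma bop0 a : bounded_op a -> a 0 = 0.
Proof.
by move=> ba; have := bopP ba (-1) 0 0; rewrite scaler0 addr0 scaleN1r addNr.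
Qed.
Lemma bopZ a : bounded_op a -> forall c u, a (c *: u) = c *: a u.
Proof. by move=> ba c u; have := bopP ba c u 0; rewrite (bop0 ba) !addr0. Qed.
Lemma bopD a : bounded_op a -> forall u v, a (u + v) = a u + a v.
Proof. by move=> ba u v; have := bopP ba 1 u v; rewrite !scale1r. Qed.
Lemma bopB a : bounded_op a -> forall u v, a (u - v) = a u - a v.
Proof. by move=> ba u v; have := bopP ba (-1) v u; rewrite !scaleN1r !(addrC (- _)). Qed.
Lemma bop_sum a : bounded_op a -> forall (I : Type) (r : seq I) (P : pred I) (F : I -> H),
  a (\sum_(i <- r | P i) F i) = \sum_(i <- r | P i) a (F i).
Proof. by move=> ba I r P F; apply: (big_morph a (bopD ba) (bop0 ba)). Qed.

Lemma bop_le a : bounded_op a -> exists2 M : K, 0 <= M & forall x, nm (a x) <= M * nm x.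
Proof. by move=> /bounded_opP[]. Qed.

Lemma bnd_id : bounded_op (idfun : op).
Proof. by split=> //; exists 1 => x; rewrite mul1r. Qed.

Lemma bnd_comp a b : bounded_op a -> bounded_op b -> bounded_op (a \o b).
Proof.
move=> /bounded_opP[la [M M0 hM]] /bounded_opP[lb [M' M0' hM']].
apply/bounded_opP; split; first by move=> c u v /=; rewrite lb la.
exists (M * M'); first exact: mulr_ge0.
move=> x /=; apply: le_trans (hM _) _; rewrite -mulrA; exact: ler_wpM2l.
Qed.

Lemma bnd_lin c a b : bounded_op a -> bounded_op b -> bounded_op (c *: a + b).
Proof.
move=> /bounded_opP[la [M M0 hM]] /bounded_opP[lb [M' M0' hM']].
apply/bounded_opP; split.
  move=> k u v; rewrite !fctE la lb !scalerDr !scalerA addrACA; congr (_ + _).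
  by rewrite mulrC.
exists (complex.Re `|c| * M + M'); first by rewrite addr_ge0 // mulr_ge0 // Re_norm_ge0.
move=> x; rewrite !fctE; apply: le_trans (nmD _ _) _; rewrite nmZ mulrDl -mulrA.
by apply: lerD => //; apply: ler_wpM2l => //; exact: Re_norm_ge0.
Qed.

Lemma bnd0 : bounded_op (0 : op).
Proof.
have := bnd_lin (-1) bnd_id bnd_id; by rewrite scaleN1r addNr.
Qed.

Lemma bnd_lspan A : A `<=` @bounded_op K H -> lspan A `<=` @bounded_op K H.
Proof.
move=> hA x; elim=> [|c a b Aa _ IH]; [exact: bnd0|].
by apply: bnd_lin => //; exact: hA.
Qed.

Lemma bnd_sum (I : Type) (r : seq I) (P : pred I) (F : I -> op) :
  (forall i, P i -> bounded_op (F i)) -> bounded_op (\sum_(i <- r | P i) F i).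
Proof.
move=> h; apply: big_ind => //; first exact: bnd0.
by move=> x y hx hy; rewrite -[x]scale1r; exact: bnd_lin.
Qed.

Lemma is_adjoint_sym a b : is_adjoint a b -> is_adjoint b a.
Proof. by move=> h x y; rewrite ipC -h -ipC. Qed.

Lemma is_adjoint_uniq a b b' : is_adjoint a b -> is_adjoint a b' -> b = b'.
Proof. by move=> h h'; apply/funext => x; apply: ip_ext => w; rewrite -h -h'. Qed.

Lemma adjE a b : is_adjoint a b -> adj a = b.
Proof.
move=> h; apply: is_adjoint_uniq (h).
by rewrite /adj; case: xgetP => [x -> //|/(_ b)]; rewrite /= => /(_ h).
Qed.

Lemma adjP a : bounded_op a -> is_adjoint a (adj a).
Proof.
move=> ba; have [M M0 hM] := bop_le ba.
have /choice[b hb] : forall y, exists w, forall x, ip H (a x) y = ip H x w.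
  move=> y; apply: (@riesz _ _ (fun x => ip H (a x) y) (M * nm y)).
    by move=> c u v; rewrite bopP // ipl.
  move=> v; apply: le_trans (cauchy_schwarz _ _) _.
  rewrite !nmE -!rmorphM lecR mulrAC; apply: ler_wpM2r; exact: nm_ge0 || exact: hM.
have h : is_adjoint a b by move=> x y; exact: hb.
by rewrite (adjE h).
Qed.

Lemma ip_adjr a : bounded_op a -> forall x y, ip H x (adj a y) = ip H (a x) y.
Proof. by move=> ba x y; rewrite (adjP ba). Qed.

Lemma ip_adjl a : bounded_op a -> forall x y, ip H (adj a x) y = ip H x (a y).
Proof. by move=> ba x y; rewrite (is_adjoint_sym (adjP ba)). Qed.

(** From [|y|^2 = <a y, x> <= M |y| |x|] for [y = adj a x]. *)
Lemma nm_adj_le a (M : K) : bounded_op a -> 0 <= M -> (forall v, nm (a v) <= M * nm v) ->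
  forall v, nm (adj a v) <= M * nm v.
Proof.
move=> ba M0 hM x; set y := adj a x.
have [->|y0] := eqVneq y 0; first by rewrite nm0 mulr_ge0 // nm_ge0.
have h : nm y ^+ 2 <= M * nm y * nm x.
  rewrite -lecR -ip_nm ip_adjr //; have h : ip H (a y) x = ip H y y by rewrite ip_adjr.
  have := cauchy_schwarz (a y) x; rewrite ger0_norm ?h ?ip_norm ?exprn_ge0 //.
  move=> /le_trans; apply; rewrite !nmE -!rmorphM lecR.
  by apply: ler_wpM2r; [exact: nm_ge0|exact: hM].
have y1 : 0 < nm y.
  by rewrite lt_neqAle nm_ge0 andbT eq_sym; apply: contra_neq y0; exact: nm_eq0.
by rewrite -(ler_pM2l y1); rewrite mulrA (mulrC (nm y) M).
Qed.

Lemma bnd_adj a : bounded_op a -> bounded_op (adj a).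
Proof.
move=> ba; have [M M0 hM] := bop_le ba; apply/bounded_opP; split.
  by move=> c u v; apply: ip_ext => w; rewrite ipr !ip_adjr // ipr.
by exists M => //; exact: nm_adj_le.
Qed.

Lemma adjK a : bounded_op a -> adj (adj a) = a.
Proof. by move=> ba; apply: adjE; apply: is_adjoint_sym; exact: adjP. Qed.

Lemma adj_comp a b : bounded_op a -> bounded_op b -> adj (a \o b) = adj b \o adj a.
Proof. by move=> ba bb; apply: adjE => x y /=; rewrite !ip_adjr. Qed.

Lemma adj_lin c a b : bounded_op a -> bounded_op b ->
  adj (c *: a + b) = c^* *: adj a + adj b.
Proof.
move=> ba bb; apply: adjE => x y; rewrite !fctE ipl ipr !ip_adjr //.
by rewrite conjCK.
Qed.

Lemma adj_id : adj (idfun : op) = idfun.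
Proof. exact: adjE. Qed.

Lemma adj0 : adj (0 : op) = 0.
Proof. by apply: adjE => x y; exact: etrans (ip0l _) (esym (ip0r _)). Qed.

Lemma adjD a b : bounded_op a -> bounded_op b -> adj (a + b) = adj a + adj b.
Proof. by move=> ba bb; rewrite -[a]scale1r adj_lin // conjC1 !scale1r. Qed.

Lemma adjZ c a : bounded_op a -> adj (c *: a) = c^* *: adj a.
Proof.
by move=> ba; rewrite -[c *: a]addr0 adj_lin // ?adj0 ?addr0 //; exact: bnd0.
Qed.

Lemma adj_sum (I : Type) (r : seq I) (P : pred I) (F : I -> op) :
  (forall i, bounded_op (F i)) ->
  adj (\sum_(i <- r | P i) F i) = \sum_(i <- r | P i) adj (F i).
Proof.
move=> h; elim: r => [|i r IH]; first by rewrite !big_nil adj0.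
rewrite !big_cons; case: ifP => // _; rewrite adjD ?IH //; exact: bnd_sum.
Qed.

Lemma comp_linl c a b (x : op) : (c *: a + b) \o x = c *: (a \o x) + (b \o x).
Proof. by []. Qed.
Lemma comp_linr c a b (x : op) : bounded_op x ->
  x \o (c *: a + b) = c *: (x \o a) + (x \o b).
Proof. by move=> bx; apply/funext => v; rewrite !fctE bopP. Qed.
Lemma comp0l (x : op) : (0 : op) \o x = 0.
Proof. by []. Qed.
Lemma comp0r (x : op) : bounded_op x -> x \o (0 : op) = 0.
Proof. by move=> bx; apply/funext => v; exact: bop0. Qed.
Lemma sum_fctE (I : Type) (r : seq I) (P : pred I) (F : I -> op) v :
  (\sum_(i <- r | P i) F i) v = \sum_(i <- r | P i) F i v.
Proof. by elim/big_rec2: _ => // i y1 y2 _ <-. Qed.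
Lemma comp_suml (I : Type) (r : seq I) (P : pred I) (F : I -> op) (x : op) :
  (\sum_(i <- r | P i) F i) \o x = \sum_(i <- r | P i) (F i \o x).
Proof. by apply/funext => v; rewrite /= !sum_fctE. Qed.
Lemma comm_lin A c x y : A `<=` @bounded_op K H ->
  commutant A x -> commutant A y -> commutant A (c *: x + y).
Proof.
move=> hA [bx hx] [by' hy]; split; first exact: bnd_lin.
move=> a Aa; rewrite comp_linl comp_linr; last exact: hA.
by rewrite hx // hy.
Qed.

Lemma comm_comp A x y : commutant A x -> commutant A y -> commutant A (x \o y).
Proof.
move=> [bx hx] [by' hy]; split; first exact: bnd_comp.
move=> a Aa; rewrite [LHS](_ : _ = (a \o x) \o y) // hx //.
by rewrite [LHS](_ : _ = x \o (a \o y)) // hy.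
Qed.

Lemma comm_id A : commutant A idfun.
Proof. by split; first exact: bnd_id. Qed.

Lemma comm_sub A B : A `<=` B -> commutant B `<=` commutant A.
Proof. by move=> AB x [bx hx]; split=> // a /AB; exact: hx. Qed.

Lemma comm_bnd A : commutant A `<=` @bounded_op K H.
Proof. by move=> x []. Qed.

Lemma comm_adj A : A `<=` @bounded_op K H -> (forall a, A a -> A (adj a)) ->
  forall x, commutant A x -> commutant A (adj x).
Proof.
move=> hA sA x [bx hx]; split; first exact: bnd_adj.
move=> a Aa; have ba := hA _ Aa; have := hx _ (sA _ Aa).
move=> /(congr1 (@adj K H)); by rewrite (adj_comp (bnd_adj ba) bx) (adj_comp bx (bnd_adj ba)) (adjK ba).
Qed.

Lemma vN_sub A B : A `<=` B -> vN_generated A `<=` vN_generated B.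
Proof. by move=> AB; apply: comm_sub; exact: comm_sub. Qed.

Lemma sub_vN A : A `<=` @bounded_op K H -> A `<=` vN_generated A.
Proof. by move=> hA x Ax; split; [exact: hA|move=> a [_ ->]]. Qed.

Lemma vN_bnd A : vN_generated A `<=` @bounded_op K H.
Proof. exact: comm_bnd. Qed.

Lemma vN_lin A c x y : vN_generated A x -> vN_generated A y -> vN_generated A (c *: x + y).
Proof. by apply: comm_lin; exact: comm_bnd. Qed.

Lemma vN_comp A x y : vN_generated A x -> vN_generated A y -> vN_generated A (x \o y).
Proof. exact: comm_comp. Qed.

Lemma vN_id A : vN_generated A idfun.
Proof. exact: comm_id. Qed.

Lemma vN_adj A : A `<=` @bounded_op K H -> (forall a, A a -> A (adj a)) ->
  forall x, vN_generated A x -> vN_generated A (adj x).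
Proof.
move=> hA sA; apply: comm_adj; first exact: comm_bnd.
exact: comm_adj.
Qed.

Lemma norm_closureP A a : norm_closure A a <-> bounded_op a /\
  forall e : K, 0 < e -> exists2 b, A b & forall x, nm (a x - b x) <= e * nm x.
Proof.
split=> -[ba h]; split=> // e e0.
  have [|b Ab hb] := h e%:C%C; first by rewrite ltcR.
  by exists b => // x; rewrite -nm_lin_le.
have eE := complex_ge0E (ltW e0); have [|b Ab hb] := h (complex.Re e).
  by rewrite -ltcR -eE.
by exists b => // x; rewrite eE nm_lin_le.
Qed.

Lemma sub_norm_closure A : A `<=` @bounded_op K H -> A `<=` norm_closure A.
Proof.
move=> hA x Ax; apply/norm_closureP; split; first exact: hA.
by move=> e e0; exists x => // v; rewrite subrr nm0 mulr_ge0 ?nm_ge0 // ltW.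
Qed.

Lemma norm_closure_bnd A : norm_closure A `<=` @bounded_op K H.
Proof. by move=> x []. Qed.

Lemma norm_closure_sub A B : A `<=` B -> norm_closure A `<=` norm_closure B.
Proof. by move=> AB x [bx h]; split=> // e /h[b Ab hb]; exists b => //; exact: AB. Qed.

Lemma norm_closure_idem A : norm_closure (norm_closure A) `<=` norm_closure A.
Proof.
move=> x /norm_closureP[bx h]; apply/norm_closureP; split=> // e e0.
have e2 : 0 < e / 2 by rewrite divr_gt0.
have [b /norm_closureP[bb h'] hb] := h _ e2; have [c Ac hc] := h' _ e2; exists c => // v.
apply: le_trans (nmB_trans (b v) _ _) _; have := hb v; have := hc v; lra.
Qed.

Lemma norm_closure_linear A c x y : (forall c x y, A x -> A y -> A (c *: x + y)) ->
  norm_closure A x -> norm_closure A y -> norm_closure A (c *: x + y).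
Proof.
move=> Alin /norm_closureP[bx hx] /norm_closureP[by' hy].
apply/norm_closureP; split; first exact: bnd_lin.
move=> e e0; set k := complex.Re `|c|; have k0 : 0 <= k := Re_norm_ge0 _.
have k1 : 0 < k + 1 by rewrite ltr_wpDl.
have e2 : 0 < e / 2 by rewrite divr_gt0.
have [b Ab hb] := hx _ (divr_gt0 e2 k1); have [b' Ab' hb'] := hy _ e2.
exists (c *: b + b'); first exact: Alin.
move=> v; rewrite !fctE opprD addrACA -scalerBr; apply: le_trans (nmD _ _) _.
rewrite nmZ -/k; have := hb' v.
have : k * nm (x v - b v) <= (k + 1) * nm (x v - b v).
  by rewrite ler_wpM2r ?nm_ge0 // lerDl.
have : (k + 1) * nm (x v - b v) <= e / 2 * nm v.
  by rewrite mulrC -ler_pdivlMr // mulrAC; exact: hb.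
lra.
Qed.

Lemma norm_closure_comp A x y : A `<=` @bounded_op K H ->
  (forall x y, A x -> A y -> A (x \o y)) ->
  norm_closure A x -> norm_closure A y -> norm_closure A (x \o y).
Proof.
move=> hA Acomp /norm_closureP[bx hx] /norm_closureP[by' hy].
apply/norm_closureP; split; first exact: bnd_comp.
move=> e e0; have e2 : 0 < e / 2 by rewrite divr_gt0.
have [M M0 hM] := bop_le bx; have M1 : 0 < M + 1 by rewrite ltr_wpDl.
have [b Ab hb] := hy _ (divr_gt0 e2 M1).
have [N N0 hN] := bop_le (hA _ Ab); have N1 : 0 < N + 1 by rewrite ltr_wpDl.
have [a Aa ha] := hx _ (divr_gt0 e2 N1).
exists (a \o b); first exact: Acomp.
move=> v /=; apply: le_trans (nmB_trans (x (b v)) _ _) _; rewrite -bopB //.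
have h1 : nm (x (y v - b v)) <= e / 2 * nm v.
  apply: le_trans (hM _) _; apply: (@le_trans _ _ ((M + 1) * nm (y v - b v))).
    by rewrite ler_wpM2r ?nm_ge0 // lerDl.
  by rewrite mulrC -ler_pdivlMr // mulrAC; exact: hb.
have h2 : nm (x (b v) - a (b v)) <= e / 2 * nm v.
  apply: le_trans (ha _) _; rewrite mulrAC ler_pdivrMr // -[X in _ <= X]mulrA.
  rewrite ler_wpM2l ?(ltW e2) // [X in _ <= X]mulrC; apply: le_trans (hN _) _.
  by rewrite ler_wpM2r ?nm_ge0 // lerDl.
lra.
Qed.

Lemma norm_closure_adj A x : A `<=` @bounded_op K H ->
  (forall x, A x -> A (adj x)) -> norm_closure A x -> norm_closure A (adj x).
Proof.
move=> hA Aadj /norm_closureP[bx hx]; apply/norm_closureP; split; first exact: bnd_adj.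
move=> e e0; have [b Ab hb] := hx _ e0; have bb := hA _ Ab.
exists (adj b); first exact: Aadj.
have E v : adj x v - adj b v = adj ((-1) *: b + x) v.
  by rewrite adj_lin // !fctE rmorphN1 scaleN1r addrC.
move=> v; rewrite E; apply: nm_adj_le; [exact: bnd_lin|exact: ltW|].
by move=> w; rewrite !fctE scaleN1r addrC; exact: hb.
Qed.

Lemma norm_closure_Cstar A : A `<=` @bounded_op K H -> A idfun ->
  (forall c x y, A x -> A y -> A (c *: x + y)) ->
  (forall x y, A x -> A y -> A (x \o y)) ->
  (forall x, A x -> A (adj x)) -> Cstar_subalgebra (norm_closure A).
Proof.
move=> hA A1 Al Ac Aa; split.
- by split; [exact: norm_closure_bnd|exact: sub_norm_closure].
- by move=> c x y; exact: norm_closure_linear.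
- by move=> x y; exact: norm_closure_comp.
- by move=> x; exact: norm_closure_adj.
- exact: norm_closure_idem.
Qed.

Lemma nm_small (v : H) (M : K) : (forall e : K, 0 < e -> nm v <= M * e) -> v = 0.
Proof. by move=> /le0_small h; apply: nm_eq0; apply/le_anti; rewrite h nm_ge0. Qed.

Lemma comm_norm_closure A : A `<=` @bounded_op K H ->
  commutant A `<=` commutant (norm_closure A).
Proof.
move=> hA x [bx hx]; split=> // a /norm_closureP[ba ha]; apply/funext => v /=.
apply/eqP; rewrite -subr_eq0; apply/eqP.
have [M M0 hM] := bop_le bx.
apply: (@nm_small _ (nm (x v) + M * nm v)) => e e0; have [b Ab hb] := ha _ e0.
have E : b (x v) = x (b v) by have /(congr1 (@^~ v)) := hx _ Ab.
apply: le_trans (nmB_trans (b (x v)) _ _) _; rewrite {2}E -bopB //.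
have h1 := hb (x v); have h2 := hM (b v - a v); have := hb v; rewrite nmBC => h3.
have : M * nm (b v - a v) <= M * (e * nm v) by rewrite ler_wpM2l.
lra.
Qed.

(** Operators are compared through their values at a cyclic vector. *)
Lemma bop_dense a b (D : set H) : bounded_op a -> bounded_op b ->
  (forall v (e : K), 0 < e -> exists2 x, D x & nm (v - x) < e) ->
  (forall x, D x -> a x = b x) -> a = b.
Proof.
move=> ba bb hD hab; apply/funext => v; apply/eqP; rewrite -subr_eq0; apply/eqP.
have [M M0 hM] := bop_le ba; have [N N0 hN] := bop_le bb.
apply: (@nm_small _ (M + N)) => e e0; have [x Dx hx] := hD v e e0.
apply: le_trans (nmB_trans (a x) _ _) _; rewrite {2}(hab x Dx) -!bopB //.
have h1 := hM (v - x); have h2 := hN (x - v); rewrite (nmBC x v) in h2.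
have : M * nm (v - x) <= M * e by rewrite ler_wpM2l // ltW.
have : N * nm (v - x) <= N * e by rewrite ler_wpM2l // ltW.
lra.
Qed.

End OpAlgebra.

(** * Words, matrix units and the canonical endomorphism *)

Section Words.
Variables (K : realType) (d : nat) (G : cuntz_gns K d).
Implicit Types (c : K[i]) (mu nu : seq 'I_d).
Local Notation C := K[i].
Local Notation op := (op G).
Implicit Types (x y z : op).
Local Notation S := (cuntzS G).
Local Notation W := (word (cuntzS G)).

Lemma bnd_S i : bounded_op (S i).
Proof. by have [h _ _] := cuntzP G. Qed.

Lemma bnd_Sa i : bounded_op (adj (S i)).
Proof. exact: bnd_adj (bnd_S i). Qed.

Lemma SaS i j v : adj (S i) (S j v) = if i == j then v else 0.
Proof.
have [_ /(_ i j) h _] := cuntzP G; have /(congr1 (@^~ v)) /= -> := h.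
by case: ifP.
Qed.

Lemma sum_SSa v : \sum_(i < d) S i (adj (S i) v) = v.
Proof.
by have [_ _ /(congr1 (@^~ v))] := cuntzP G; rewrite sum_fctE.
Qed.

Lemma bnd_W mu : bounded_op (W mu).
Proof.
elim: mu => [|i mu IH]; first exact: bnd_id.
exact: bnd_comp (bnd_S i) IH.
Qed.

Lemma bnd_Wa mu : bounded_op (adj (W mu)).
Proof. exact: bnd_adj (bnd_W mu). Qed.

Lemma W_cat mu nu : W (mu ++ nu) = W mu \o W nu.
Proof. by elim: mu => //= i mu ->. Qed.

Lemma Wa_cons i mu : adj (W (i :: mu)) = adj (W mu) \o adj (S i).
Proof. exact: adj_comp (bnd_S i) (bnd_W mu). Qed.

Lemma Wa_cat mu nu : adj (W (mu ++ nu)) = adj (W nu) \o adj (W mu).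
Proof. by rewrite W_cat (adj_comp (bnd_W _) (bnd_W _)). Qed.

Definition munit mu nu : op := W mu \o adj (W nu).

Lemma bnd_munit mu nu : bounded_op (munit mu nu).
Proof. exact: bnd_comp (bnd_W _) (bnd_Wa _). Qed.

Lemma adj_munit mu nu : adj (munit mu nu) = munit nu mu.
Proof. by rewrite /munit (adj_comp (bnd_W _) (bnd_Wa _)) (adjK (bnd_W _)). Qed.

Lemma WaW mu nu : size mu = size nu -> adj (W mu) \o W nu = if mu == nu then idfun else 0.
Proof.
elim: mu nu => [|i mu IH] [|j nu] //=; first by rewrite adj_id.
move=> [/IH h]; rewrite Wa_cons eqseq_cons; apply/funext => v /=; rewrite SaS.
case: eqP => _ /=; first by rewrite -h.
by rewrite (bop0 (bnd_Wa mu)).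
Qed.

Lemma munit_mul mu nu mu' nu' : size nu = size mu' ->
  munit mu nu \o munit mu' nu' = if nu == mu' then munit mu nu' else 0.
Proof.
move=> /WaW h; rewrite [LHS](_ : _ = W mu \o (adj (W nu) \o W mu') \o adj (W nu')) // h.
case: ifP => // _; apply/funext => v /=; exact: bop0 (bnd_W _).
Qed.

Lemma Sa_munit_cons i j mu nu :
  adj (S i) \o munit (j :: mu) nu = if i == j then munit mu nu else 0.
Proof. by apply/funext => v; rewrite /= SaS; case: ifP. Qed.

Lemma Sa_munit_nil i nu : adj (S i) \o munit [::] nu = munit [::] (rcons nu i).
Proof.
rewrite /munit -cats1 Wa_cat; apply/funext => v /=.
by congr (adj _ _).
Qed.

Lemma lspan_comp (A B D : set op) : A `<=` @bounded_op K G ->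
  (forall a b, A a -> B b -> lspan D (a \o b)) ->
  forall x y, lspan A x -> lspan B y -> lspan D (x \o y).
Proof.
move=> hA h x y hx hy; elim: hx => [|c a x' Aa hx' IH]; first exact: lspan0.
rewrite comp_linl; apply: lspan_lin => //.
elim: hy => [|k b y' Bb hy' IHy]; first by rewrite comp0r; [exact: lspan0|exact: hA].
by rewrite comp_linr; [apply: lspan_lin => //; exact: h|exact: hA].
Qed.

Lemma lspan_comp_l (A D : set op) a : bounded_op a ->
  (forall b, A b -> lspan D (a \o b)) -> forall y, lspan A y -> lspan D (a \o y).
Proof.
move=> ba h y hy; apply: (@lspan_comp [set a] A D) hy => //.
- by move=> _ ->.
- by move=> _ b -> Ab; exact: h.
- exact: lspan_gen.
Qed.

Lemma lspan_adj (A D : set op) : A `<=` @bounded_op K G ->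
  (forall a, A a -> lspan D (adj a)) -> forall x, lspan A x -> lspan D (adj x).
Proof.
move=> hA h x; elim=> [|c a b Aa hb IH]; first by rewrite adj0; exact: lspan0.
rewrite adj_lin; [|exact: hA|exact: bnd_lspan hA _ hb].
by apply: lspan_lin => //; exact: h.
Qed.

(** The polynomials in the generators of degree [k] for the gauge action; those
    of degree 0 form the union of the levels of the UHF algebra. *)
Definition homog (k : int) : set op :=
  lspan [set x | exists mu nu, (size mu)%:Z - (size nu)%:Z = k /\ x = munit mu nu].

Lemma munit_homog mu nu : homog ((size mu)%:Z - (size nu)%:Z) (munit mu nu).
Proof. by apply: lspan_gen; exists mu, nu. Qed.

Lemma bnd_homog k : homog k `<=` @bounded_op K G.
Proof. by apply: bnd_lspan => _ [mu [nu [_ ->]]]; exact: bnd_munit. Qed.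

Lemma homog_S k i x : homog k x -> homog (k + 1) (S i \o x).
Proof.
apply: lspan_comp_l; first exact: bnd_S.
move=> _ [mu [nu [<- ->]]]; apply: lspan_gen; exists (i :: mu), nu; split=> //=.
lia.
Qed.

(** Products of words need no case analysis on common prefixes: multiplying by
    one adjoint generator on the left cancels a letter, gives 0, or lengthens the
    right-hand word. *)
Lemma homog_Sa k i x : homog k x -> homog (k - 1) (adj (S i) \o x).
Proof.
apply: lspan_comp_l; first exact: bnd_Sa.
move=> _ [[|j mu] [nu [<- ->]]].
  rewrite Sa_munit_nil; apply: lspan_gen; exists [::], (rcons nu i); split=> //.
  by rewrite size_rcons /=; lia.
rewrite Sa_munit_cons; case: eqP => _; last exact: lspan0.
by apply: lspan_gen; exists mu, nu; split=> //=; lia.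
Qed.

Lemma homog_W k mu x : homog k x -> homog (k + (size mu)%:Z) (W mu \o x).
Proof.
elim: mu => [|i mu IH] hx; first by rewrite addr0.
by rewrite (_ : k + _ = k + (size mu)%:Z + 1); [apply: homog_S; exact: IH|rewrite /=; lia].
Qed.

Lemma homog_Wa k mu x : homog k x -> homog (k - (size mu)%:Z) (adj (W mu) \o x).
Proof.
elim: mu k x => [|i mu IH] k x hx; first by rewrite subr0 /= adj_id.
rewrite Wa_cons (_ : k - _ = k - 1 - (size mu)%:Z); last by rewrite /=; lia.
by apply: IH; exact: homog_Sa.
Qed.

Lemma homog_comp k l x y : homog k x -> homog l y -> homog (k + l) (x \o y).
Proof.
move=> hx hy; elim: hx => [|c a b [mu [nu [<- ->]]] _ IH]; first exact: lspan0.
rewrite comp_linl; apply: lspan_lin => //.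
rewrite (_ : _ + l = l - (size nu)%:Z + (size mu)%:Z); last lia.
by apply: homog_W; exact: homog_Wa.
Qed.

Lemma homog_adj k x : homog k x -> homog (- k) (adj x).
Proof.
apply: lspan_adj => [_ [mu [nu [_ ->]]]|_ [mu [nu [<- ->]]]]; first exact: bnd_munit.
by rewrite adj_munit opprB; exact: munit_homog.
Qed.

(** The *-algebra generated by the isometries. *)
Definition cpoly : set op := lspan [set x | exists k, homog k x].

Lemma bnd_cpoly : cpoly `<=` @bounded_op K G.
Proof. by apply: bnd_lspan => x [k]; exact: bnd_homog. Qed.

Lemma homog_cpoly k x : homog k x -> cpoly x.
Proof. by move=> h; apply: lspan_gen; exists k. Qed.

Lemma munit_cpoly mu nu : cpoly (munit mu nu).
Proof. exact: homog_cpoly (munit_homog mu nu). Qed.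

Lemma munit_S i : munit [:: i] [::] = S i.
Proof. by rewrite /munit /= adj_id. Qed.

Lemma munit_nil : munit [::] [::] = idfun.
Proof. by rewrite /munit /= adj_id. Qed.

Lemma cpoly_S i : cpoly (S i).
Proof. by rewrite -munit_S; exact: munit_cpoly. Qed.

Lemma cpoly_id : cpoly idfun.
Proof. by rewrite -munit_nil; exact: munit_cpoly. Qed.

Lemma cpoly_lin c x y : cpoly x -> cpoly y -> cpoly (c *: x + y).
Proof. exact: lspan_lin. Qed.

Lemma cpoly_comp x y : cpoly x -> cpoly y -> cpoly (x \o y).
Proof.
apply: lspan_comp => [a [k]|a b [k ha] [l hb]]; first exact: bnd_homog.
by apply: lspan_gen; exists (k + l); exact: homog_comp.
Qed.

Lemma cpoly_adj x : cpoly x -> cpoly (adj x).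
Proof.
apply: lspan_adj => [a [k]|a [k ha]]; first exact: bnd_homog.
by apply: lspan_gen; exists (- k); exact: homog_adj.
Qed.

Lemma cpoly_munit x : cpoly x -> lspan [set y | exists mu nu, y = munit mu nu] x.
Proof.
elim=> [|c a b [k ha] _ IH]; first exact: lspan0.
apply: lspan_lin => //; apply: lspan_sub ha => _ [mu [nu [_ ->]]].
by exists mu, nu.
Qed.

Lemma FnE n x : Fn G n x <->
  lspan [set y | exists mu nu : n.-tuple 'I_d, y = munit mu nu] x.
Proof.
split=> [[A ->]|].
  apply: lspan_sum => mu _; apply: lspan_sum => nu _; apply: lspanZ.
  by apply: lspan_gen; exists mu, nu.
elim=> [|c _ b [mu [nu ->]] _ [A ->]].
  exists (fun _ _ => 0); rewrite big1 // => mu _; rewrite big1 // => nu _.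
  by rewrite scale0r.
exists (fun m n => (if (m == mu) && (n == nu) then c else 0) + A m n).
under [RHS]eq_bigr do under eq_bigr do rewrite scalerDl.
under [RHS]eq_bigr do rewrite big_split /=.
rewrite big_split /=; congr (_ + _).
rewrite (bigD1 mu) //= (bigD1 nu) //= !eqxx /= !big1 ?addr0 //.
  move=> m /negPf ->; rewrite big1 // => n0 _; by rewrite scale0r.
by move=> n0 /negPf ->; rewrite scale0r.
Qed.

Lemma munit_Fn n mu nu : size mu = n -> size nu = n -> Fn G n (munit mu nu).
Proof.
move=> /eqP hm /eqP hn; apply/FnE; apply: lspan_gen.
by exists (Tuple hm), (Tuple hn).
Qed.

Lemma bnd_Fn n : Fn G n `<=` @bounded_op K G.
Proof.
move=> x /FnE; apply: bnd_lspan => _ [mu [nu ->]]; exact: bnd_munit.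
Qed.

Lemma Fn_lin n c x y : Fn G n x -> Fn G n y -> Fn G n (c *: x + y).
Proof. by move=> /FnE hx /FnE hy; apply/FnE; exact: lspan_lin. Qed.

Lemma Fn_lspan n (A : set op) : A `<=` Fn G n -> lspan A `<=` Fn G n.
Proof.
move=> h x; elim=> [|c a b Aa _ IH]; first by apply/FnE; exact: lspan0.
by apply: Fn_lin => //; exact: h.
Qed.

Lemma Fn_sum n (I : Type) (r : seq I) (P : pred I) (F : I -> op) :
  (forall i, P i -> Fn G n (F i)) -> Fn G n (\sum_(i <- r | P i) F i).
Proof. by move=> h; apply/FnE; apply: lspan_sum => i /h /FnE. Qed.

(** A linear property of the elements of a level is checked on matrix units. *)
Lemma Fn_ind n (Q : op -> Prop) : Q 0 ->
  (forall c x y, Fn G n x -> Fn G n y -> Q x -> Q y -> Q (c *: x + y)) ->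
  (forall mu nu, size mu = n -> size nu = n -> Q (munit mu nu)) ->
  forall x, Fn G n x -> Q x.
Proof.
move=> Q0 Ql Qu x /FnE; elim=> // c _ b [mu [nu ->]] /FnE hb IH.
by apply: Ql => //; [apply: munit_Fn; rewrite size_tuple|apply: Qu; rewrite size_tuple].
Qed.

Lemma Fn_comp n x y : Fn G n x -> Fn G n y -> Fn G n (x \o y).
Proof.
move=> /FnE hx /FnE hy; apply/FnE; apply: lspan_comp hx hy.
  by move=> _ [mu [nu ->]]; exact: bnd_munit.
move=> _ _ [mu [nu ->]] [mu' [nu' ->]]; rewrite munit_mul ?size_tuple //.
case: ifP => _; last exact: lspan0.
by apply: lspan_gen; exists mu, nu'.
Qed.

Lemma Fn_adj n x : Fn G n x -> Fn G n (adj x).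
Proof.
move=> /FnE hx; apply/FnE; apply: lspan_adj hx.
  by move=> _ [mu [nu ->]]; exact: bnd_munit.
by move=> _ [mu [nu ->]]; rewrite adj_munit; apply: lspan_gen; exists nu, mu.
Qed.

Lemma munit_split mu nu : munit mu nu = \sum_(i < d) munit (rcons mu i) (rcons nu i).
Proof.
apply/funext => v; rewrite sum_fctE.
rewrite -[LHS]/(W mu (adj (W nu) v)) -{1}(sum_SSa (adj (W nu) v)) (bop_sum (bnd_W mu)).
by apply: eq_bigr => i _; rewrite /munit -!cats1 W_cat Wa_cat /=.
Qed.

Lemma Fn_S n x : Fn G n x -> Fn G n.+1 x.
Proof.
move=> /FnE; apply: Fn_lspan => _ [mu [nu ->]]; rewrite munit_split.
by apply: Fn_sum => i _; apply: munit_Fn; rewrite size_rcons size_tuple.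
Qed.

Lemma Fn_le m n x : (m <= n)%N -> Fn G m x -> Fn G n x.
Proof.
move=> /subnK <-; elim: (n - m)%N => // k IH /IH; exact: Fn_S.
Qed.

Lemma Fn_id n : Fn G n idfun.
Proof. by apply: (@Fn_le 0) => //; rewrite -munit_nil; exact: munit_Fn. Qed.

Lemma Fn0E x : Fn G 0 x -> exists c, x = c *: idfun.
Proof.
move: x; apply: Fn_ind; first by exists 0; rewrite scale0r.
  by move=> c x y _ _ [a ->] [b ->]; exists (c * a + b); rewrite scalerDl scalerA.
by move=> mu nu /size0nil -> /size0nil ->; exists 1; rewrite munit_nil scale1r.
Qed.

Lemma Fn_homog n x : Fn G n x -> homog 0 x.
Proof.
move=> /FnE; apply: lspan_sub => _ [mu [nu ->]].
by exists mu, nu; rewrite !size_tuple subrr.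
Qed.

Lemma homog_Fn x : homog 0 x -> exists n, Fn G n x.
Proof.
elim=> [|c _ b [mu [nu [h ->]]] _ [n hn]].
  by exists 0%N; apply/FnE; exact: lspan0.
exists (maxn n (size mu)); apply: Fn_lin.
  by apply: (@Fn_le (size mu)); [exact: leq_maxr|apply: munit_Fn; lia].
by apply: Fn_le hn; exact: leq_maxl.
Qed.

Local Notation phi := (phi G).

Lemma phiE x v : phi x v = \sum_(i < d) S i (x (adj (S i) v)).
Proof. by rewrite /phi sum_fctE. Qed.

Lemma bnd_phi x : bounded_op x -> bounded_op (phi x).
Proof.
move=> bx; apply: bnd_sum => i _.
exact: bnd_comp (bnd_comp (bnd_S i) bx) (bnd_Sa i).
Qed.

Lemma phi_S x i : bounded_op x -> phi x \o S i = S i \o x.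
Proof.
move=> bx; apply/funext => v /=; rewrite phiE (bigD1 i) //= SaS eqxx big1 ?addr0 //.
by move=> j /negPf ji; rewrite SaS ji (bop0 bx) (bop0 (bnd_S j)).
Qed.

Lemma Sa_phi x i : adj (S i) \o phi x = x \o adj (S i).
Proof.
apply/funext => v /=; rewrite phiE (bop_sum (bnd_Sa i)) (bigD1 i) //= SaS eqxx big1 ?addr0 //.
by move=> j; rewrite eq_sym => /negPf ji; rewrite SaS ji.
Qed.

Lemma phi_lin c x y : phi (c *: x + y) = c *: phi x + phi y.
Proof.
apply/funext => v; rewrite !fctE !phiE scaler_sumr -big_split /=.
by apply: eq_bigr => i _; rewrite -(bopP (bnd_S i)).
Qed.

Lemma phi0 : phi 0 = 0.
Proof.
by apply/funext => v; rewrite phiE big1 // => i _; exact: bop0 (bnd_S i).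
Qed.

Lemma phi_comp x y : bounded_op x -> phi (x \o y) = phi x \o phi y.
Proof.
move=> bx; apply/funext => v /=; rewrite [LHS]phiE [phi y v]phiE.
rewrite (bop_sum (bnd_phi bx)); apply: eq_bigr => i _ /=.
by have /(congr1 (@^~ (y (adj (S i) v)))) := phi_S i bx => /= ->.
Qed.

Lemma phi_id : phi idfun = idfun.
Proof. by apply/funext => v; rewrite phiE sum_SSa. Qed.

Lemma phi_adj x : bounded_op x -> phi (adj x) = adj (phi x).
Proof.
move=> bx; rewrite /Defs.phi adj_sum; last first.
  by move=> i; exact: bnd_comp (bnd_comp (bnd_S i) bx) (bnd_Sa i).
apply: eq_bigr => i _.
rewrite (adj_comp (bnd_comp (bnd_S i) bx) (bnd_Sa i)) (adj_comp (bnd_S i) bx).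
by rewrite (adjK (bnd_S i)).
Qed.

Lemma phi_munit mu nu : phi (munit mu nu) = \sum_(i < d) munit (i :: mu) (i :: nu).
Proof.
apply: eq_bigr => i _; rewrite /munit Wa_cons; by apply/funext.
Qed.

Lemma Fn_phi n x : Fn G n x -> Fn G n.+1 (phi x).
Proof.
move: x; apply: Fn_ind; first by rewrite phi0; apply/FnE; exact: lspan0.
  by move=> c x y _ _ hx hy; rewrite phi_lin; exact: Fn_lin.
move=> mu nu hm hn; rewrite phi_munit; apply: Fn_sum => i _.
by apply: munit_Fn => /=; rewrite ?hm ?hn.
Qed.

Local Notation phin n := (iter n phi).

Lemma bnd_phin n x : bounded_op x -> bounded_op (phin n x).
Proof. by move=> bx; elim: n => //= n; exact: bnd_phi. Qed.

Lemma phin_lin n c x y : phin n (c *: x + y) = c *: phin n x + phin n y.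
Proof. by elim: n => //= n ->; exact: phi_lin. Qed.

Lemma phin_comp n x y : bounded_op x -> phin n (x \o y) = phin n x \o phin n y.
Proof. by move=> bx; elim: n => //= n ->; rewrite phi_comp //; exact: bnd_phin. Qed.

Lemma phin_id n : phin n idfun = idfun.
Proof. by elim: n => //= n ->; exact: phi_id. Qed.

Lemma phin0 n : phin n 0 = 0.
Proof. by elim: n => //= n ->; exact: phi0. Qed.

Lemma phin_adj n x : bounded_op x -> phin n (adj x) = adj (phin n x).
Proof. by move=> bx; elim: n => //= n ->; rewrite phi_adj //; exact: bnd_phin. Qed.

Lemma Fn_phin m n x : Fn G m x -> Fn G (n + m) (phin n x).
Proof. by move=> hx; elim: n => // n; exact: Fn_phi. Qed.

Lemma phin_W n x mu : bounded_op x -> size mu = n -> phin n x \o W mu = W mu \o x.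
Proof.
move=> bx <-; elim: mu => //= i mu IH; rewrite -[LHS]/((phi (phin (size mu) x) \o S i) \o W mu).
by rewrite (phi_S _ (bnd_phin _ bx)) -[RHS]/(S i \o (W mu \o x)) -IH.
Qed.

Lemma Wa_phin n x mu : size mu = n -> adj (W mu) \o phin n x = x \o adj (W mu).
Proof.
move=> <-; elim: mu => [|i mu IH] /=; first by rewrite adj_id.
rewrite Wa_cons -[LHS]/(adj (W mu) \o (adj (S i) \o phi (phin (size mu) x))) Sa_phi.
by rewrite -[LHS]/((adj (W mu) \o (phin (size mu) x)) \o adj (S i)) IH.
Qed.

(** In the tensor product picture [phin n x] acts on the factors after the
    [n]-th, and a level [n] element on the first [n] factors. *)
Lemma Fn_commute n x y : bounded_op x -> Fn G n y -> y \o phin n x = phin n x \o y.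
Proof.
move=> bx; move: y; apply: Fn_ind.
- by rewrite comp0r //; exact: bnd_phin.
- move=> c y z _ _ hy hz; rewrite comp_linl comp_linr ?hy ?hz //; exact: bnd_phin.
move=> mu nu hm hn.
rewrite -[LHS]/(W mu \o (adj (W nu) \o phin n x)) (Wa_phin _ hn).
by rewrite -[RHS]/((phin n x \o W mu) \o adj (W nu)) (phin_W bx hm).
Qed.

(** [M_d^(n+m)] is spanned by the elementary tensors [y (x) z]. *)
Lemma Fn_split n m x : Fn G (n + m) x ->
  lspan [set x | exists y z, [/\ Fn G n y, Fn G m z & x = y \o phin n z]] x.
Proof.
move: x; apply: Fn_ind; [exact: lspan0|by move=> *; exact: lspan_lin|].
move=> mu nu hm hn; apply: lspan_gen.
exists (munit (take n mu) (take n nu)), (munit (drop n mu) (drop n nu)).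
have s1 (s : seq 'I_d) : size s = (n + m)%N -> size (take n s) = n.
  by move=> h; rewrite size_takel // h leq_addr.
have s2 (s : seq 'I_d) : size s = (n + m)%N -> size (drop n s) = m.
  by move=> h; rewrite size_drop h addKn.
split; [exact: munit_Fn (s1 _ hm) (s1 _ hn)|exact: munit_Fn (s2 _ hm) (s2 _ hn)|].
rewrite -[RHS]/(W (take n mu) \o (adj (W (take n nu)) \o phin n _)).
by rewrite (Wa_phin _ (s1 _ hn)) /munit -{1}(cat_take_drop n mu) -{1}(cat_take_drop n nu) W_cat Wa_cat.
Qed.

End Words.

(** * The quasi-free state on words *)

Lemma sin_cos_2kpi (K : realType) (k : nat) :
  sin (k%:R * (2 * pi)) = 0 :> K /\ cos (k%:R * (2 * pi)) = 1 :> K.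
Proof.
elim: k => [|k [hs hc]]; first by rewrite mul0r sin0 cos0.
rewrite -natr1 mulrDl mul1r sinD cosD hs hc.
by rewrite mulr_natl sin2pi cos2pi; split; ring.
Qed.

Lemma integral_trig_period (K : realType) (a b : K) (k : nat) : (0 < k)%N ->
  \int[lebesgue_measure]_(t in `[0, 2 * pi]) (a * cos (k%:R * t) + b * sin (k%:R * t)) = 0.
Proof.
move=> k0; have kr : k%:R != 0 :> K by rewrite pnatr_eq0 -lt0n.
pose F (t : K) := k%:R^-1 * (a * sin (k%:R * t) - b * cos (k%:R * t)).
pose f (t : K) := a * cos (k%:R * t) + b * sin (k%:R * t).
have dF t : is_derive t (1 : K) F (f t).
  apply: is_derive_eq; rewrite /f /GRing.scale /=.
  by field.
have df t : derivable f t 1 by exact: ex_derive.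
rewrite /Rintegral (@continuous_FTC2 K f F) //.
- have [s1 c1] := sin_cos_2kpi K k.
  by rewrite -EFinB /= /F s1 c1 !mulr0 sin0 cos0; ring.
- by rewrite mulr_gt0 // pi_gt0.
- by apply: derivable_within_continuous => t _.
- have cF t : {for t, continuous F}.
    apply: differentiable_continuous; apply/derivable1_diffP; exact: ex_derive.
  split=> [t _||]; first exact: ex_derive.
    by apply: cvg_at_right_filter; exact: cF.
  by apply: cvg_at_left_filter; exact: cF.
- by move=> t _; rewrite derive1E; exact: derive_val.
Qed.

Section State.
Variables (K : realType) (d : nat) (G : cuntz_gns K d).
Implicit Types (c : K[i]) (mu nu : seq 'I_d).
Local Notation C := K[i].
Local Notation op := (op G).
Implicit Types (x y z : op) (v w : G).
Local Notation S := (cuntzS G).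
Local Notation W := (word (cuntzS G)).
Local Notation O := (Cuntz_algebra (cuntzS G)).
Local Notation F := (UHF_algebra (cuntzS G)).
Local Notation Om := (Omega G).

Lemma Cstar_closure_cpoly : Cstar_subalgebra (norm_closure (cpoly (G := G))).
Proof.
apply: norm_closure_Cstar; first exact: bnd_cpoly.
- exact: cpoly_id.
- exact: cpoly_lin.
- exact: cpoly_comp.
- exact: cpoly_adj.
Qed.

Lemma Cuntz_sub_closure : O `<=` norm_closure (cpoly (G := G)).
Proof.
apply: smallest_sub; first exact: Cstar_closure_cpoly.
by move=> _ [i _ <-]; apply: sub_norm_closure; [exact: bnd_cpoly|exact: cpoly_S].
Qed.

Lemma Cuntz_bnd : O `<=` @bounded_op K G.
Proof. by move=> x /Cuntz_sub_closure; exact: norm_closure_bnd. Qed.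

Lemma Cuntz_id : O idfun.
Proof. by move=> A [[[_ h] _ _ _ _] _]; exact: h. Qed.

Lemma Cuntz_S i : O (S i).
Proof. by move=> A [_ h]; apply: h; exists i. Qed.

Lemma Cuntz_lin c x y : O x -> O y -> O (c *: x + y).
Proof. by move=> hx hy A hA; have [[_ h _ _ _] _] := hA; apply: h; [exact: hx|exact: hy]. Qed.

Lemma Cuntz_comp x y : O x -> O y -> O (x \o y).
Proof. by move=> hx hy A hA; have [[_ _ h _ _] _] := hA; apply: h; [exact: hx|exact: hy]. Qed.

Lemma Cuntz_adj x : O x -> O (adj x).
Proof. by move=> hx A hA; have [[_ _ _ h _] _] := hA; apply: h; exact: hx. Qed.

Lemma Cuntz_closed : norm_closure O `<=` O.
Proof.
move=> x hx A hA; have [[_ _ _ _ h] _] := hA; apply: h.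
by apply: norm_closure_sub hx => y; exact.
Qed.

Lemma Cuntz_0 : O 0.
Proof. by have := Cuntz_lin (-1) Cuntz_id Cuntz_id; rewrite scaleN1r addNr. Qed.

Lemma Cuntz_W mu : O (W mu).
Proof. by elim: mu => [|i mu]; [exact: Cuntz_id|apply: Cuntz_comp; exact: Cuntz_S]. Qed.

Lemma Cuntz_munit mu nu : O (munit mu nu).
Proof. by apply: Cuntz_comp (Cuntz_W _) _; apply: Cuntz_adj; exact: Cuntz_W. Qed.

Lemma Cuntz_lspan (A : set op) : A `<=` O -> lspan A `<=` O.
Proof.
move=> h x; elim=> [|c a b Aa _ IH]; first exact: Cuntz_0.
by apply: Cuntz_lin => //; exact: h.
Qed.

Lemma cpoly_Cuntz : cpoly (G := G) `<=` O.
Proof. by move=> x /cpoly_munit; apply: Cuntz_lspan => _ [mu [nu ->]]; exact: Cuntz_munit. Qed.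

Lemma Fn_UHF n : Fn G n `<=` F.
Proof.
move=> x hx; apply: (@sub_norm_closure _ _ (\bigcup_n Fn G n)).
  by move=> y [m _]; exact: bnd_Fn.
by exists n.
Qed.

Lemma UHF_sub_Cuntz : F `<=` O.
Proof.
move=> x hx; apply: Cuntz_closed; apply: norm_closure_sub hx => y [n _].
by move=> /(@Fn_homog _ _ G) /homog_cpoly; exact: cpoly_Cuntz.
Qed.

Lemma UHF_bnd : F `<=` @bounded_op K G.
Proof. exact: norm_closure_bnd. Qed.

Lemma UHF_adj x : F x -> F (adj x).
Proof.
apply: norm_closure_adj; first by move=> y [m _]; exact: bnd_Fn.
by move=> y [n _ /Fn_adj hy]; exists n.
Qed.

Lemma UHF_lin c x y : F x -> F y -> F (c *: x + y).
Proof.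
apply: norm_closure_linear => k a b [n _ ha] [m _ hb]; exists (maxn n m) => //.
apply: Fn_lin; [exact: Fn_le (leq_maxl _ _) ha|exact: Fn_le (leq_maxr _ _) hb].
Qed.

(** Cyclicity is assumed for the C*-algebra; polynomials suffice because they
    are norm dense in it. *)
Lemma cpoly_dense v (e : K) : 0 < e ->
  exists2 w, [set x Om | x in cpoly (G := G)] w & nm (v - w) < e.
Proof.
move=> e0; have e2 : 0 < e / 2 by rewrite divr_gt0.
have : closure [set x Om | x in O] v by rewrite Omega_cyclic.
have e2c : 0 < (e / 2)%:C%C by rewrite ltcR.
move=> /(_ _ (nbhsx_ballx v _ e2c)) [_ [[x Ox <-]]]; rewrite -ball_normE /= nmE ltcR => h1.
have /norm_closureP[bx hx] := Cuntz_sub_closure Ox.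
have N1 : 0 < nm Om + 1 by rewrite ltr_wpDl // nm_ge0.
have [y cy hy] := hx _ (divr_gt0 e2 N1).
exists (y Om); first by exists y.
apply: le_lt_trans (nmB_trans (x Om) _ _) _.
have h2 : nm (x Om - y Om) <= e / 2.
  apply: le_trans (hy _) _; rewrite mulrAC ler_pdivrMr // ler_wpM2l ?(ltW e2) //.
  by rewrite lerDl.
lra.
Qed.

Lemma omega_lin c x y : omega (c *: x + y) = c * omega x + omega y.
Proof. exact: ipl. Qed.

Lemma omega0 : omega (0 : op) = 0.
Proof. exact: ip0l. Qed.

Lemma omegaZ c x : omega (c *: x) = c * omega x.
Proof. exact: ipZl. Qed.

Lemma omegaD x y : omega (x + y) = omega x + omega y.
Proof. exact: ipDl. Qed.

Lemma omega_sum (I : Type) (r : seq I) (P : pred I) (f : I -> op) :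
  omega (\sum_(i <- r | P i) f i) = \sum_(i <- r | P i) omega (f i).
Proof. exact: (big_morph (@omega K d G) omegaD omega0). Qed.

Lemma omega_adj x : bounded_op x -> omega (adj x) = (omega x)^*.
Proof. by move=> bx; rewrite /omega ip_adjl // -ipC. Qed.

Lemma exp_itX (t : K) n :
  (cos t +i* sin t)%C ^+ n = (cos (n%:R * t) +i* sin (n%:R * t))%C.
Proof.
elim: n => [|n IH]; first by rewrite expr0 mul0r cos0 sin0.
rewrite exprS IH -natr1 mulrDl mul1r sinD cosD; apply/eqP.
by rewrite eq_complex /=; apply/andP; split; apply/eqP; ring.
Qed.

Lemma exp_it_norm (t : K) : (cos t +i* sin t)%C * (cos t +i* sin t)%C^* = 1.
Proof.
apply/eqP; rewrite eq_complex /=; apply/andP; split; apply/eqP; last by ring.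
by rewrite -(cos2Dsin2 t); ring.
Qed.

(** For words of the same length the gauge mean is trivial, and the trace is
    determined on matrix units by the trace property. If the lengths differ by
    [k > 0], the factor [exp(ikt)] of the gauge action integrates to 0 over a
    period. *)
Lemma omega_munit mu nu : omega (munit mu nu : op) = if mu == nu then (d%:R ^+ size mu)^-1 else 0.
Proof.
have [tr [gauge [E0 [[trl trp tr1 trc] hg hE hw]]]] := Omega_state G.
have tr0 : tr 0 = 0.
  have F1 : F idfun by apply: (@Fn_UHF 0); exact: Fn_id.
  by have := trl (-1) _ _ F1 F1; rewrite scaleN1r addNr mulN1r addNr.
pose e (t : K) : C := (cos t +i* sin t)%C.
have gW t al : gauge t (W al) = (e t) ^+ size al *: W al.
  have [gO gh gS] := hg t; elim: al => [|i al IH] /=.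
    by rewrite (hom_one gh) expr0 scale1r.
  rewrite (hom_mul gh (Cuntz_S i) (Cuntz_W al)) IH gS exprS.
  apply/funext => v; rewrite !fctE /= (bopZ (bnd_S G i)).
  by rewrite scalerA.
have gU t al be : gauge t (munit al be : op) = (e t ^+ size al * (e t ^+ size be)^*) *: munit al be.
  have [gO gh gS] := hg t.
  rewrite (hom_mul gh (Cuntz_W al) (Cuntz_adj (Cuntz_W be))) (hom_adj gh (Cuntz_W be)) !gW.
  rewrite (adjZ _ (bnd_W G be)); apply/funext => v; rewrite !fctE /= (bopZ (bnd_W G al)).
  by rewrite scalerA.
have ee t : e t * (e t)^* = 1 := exp_it_norm t.
have pi2 : 0 < 2 * pi :> K by rewrite mulr_gt0 // pi_gt0.
have eqlen al be : size al = size be -> omega (munit al be : op) = tr (munit al be : op).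
  move=> ab; rewrite /omega hw; last exact: Cuntz_munit.
  congr tr; have [_ hEx] := hE _ (Cuntz_munit al be).
  apply/funext => v; apply/esym; apply: ip_ext => w.
  apply: (can_inj conjCK); rewrite -!ipC; apply/esym.
  rewrite hEx /=.
  have gx t : gauge t (munit al be : op) = munit al be.
    by rewrite gU ab rmorphXn -exprMn ee expr1n scale1r.
  under eq_Rintegral do rewrite gx.
  under [X in (_ +i* X)%C]eq_Rintegral do rewrite gx.
  rewrite !Rintegral_cst //= lebesgue_measure_itv /= lte_fin pi2 /= subr0.
  have : pi != 0 :> K by rewrite gt_eqF // pi_gt0.
  move: (@pi K) => p pn; case: (ip G _ _) => a b.
  by apply/eqP; rewrite eq_complex /=; apply/andP; split; apply/eqP; field; exact: pn.
have gtlen al be : (size be < size al)%N -> omega (munit al be : op) = 0.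
  move=> ab; rewrite /omega hw; last exact: Cuntz_munit.
  suff -> : E0 (munit al be) = 0 by [].
  have [_ hEx] := hE _ (Cuntz_munit al be).
  apply/funext => v; apply/esym; apply: ip_ext => w.
  apply: (can_inj conjCK); rewrite -!ipC; apply/esym.
  rewrite hEx /= ip0l.
  have k0 : (0 < size al - size be)%N by rewrite subn_gt0.
  set k := (_ - _)%N in k0.
  have gx t : gauge t (munit al be : op) = e t ^+ k *: munit al be.
    rewrite gU -(subnK (ltnW ab)) -/k exprD rmorphXn -mulrA -exprMn ee expr1n mulr1.
    by [].
  under eq_Rintegral do rewrite gx.
  under [X in (_ +i* X)%C]eq_Rintegral do rewrite gx.
  set z := ip G (munit al be v) w.
  have fE t : ip G ((e t ^+ k *: munit al be) v) w = (cos (k%:R * t) +i* sin (k%:R * t))%C * z.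
    by rewrite fctE ipZl exp_itX.
  under eq_Rintegral do rewrite fE.
  under [X in (_ +i* X)%C]eq_Rintegral do rewrite fE.
  case: z {fE} => a b /=.
  have -> : \int[lebesgue_measure]_(t in `[0, 2 * pi]) (cos (k%:R * t) * a - sin (k%:R * t) * b) = 0.
    rewrite -[RHS](integral_trig_period a (- b) k0); apply: eq_Rintegral => t _; ring.
  have -> : \int[lebesgue_measure]_(t in `[0, 2 * pi]) (cos (k%:R * t) * b + sin (k%:R * t) * a) = 0.
    rewrite -[RHS](integral_trig_period b a k0); apply: eq_Rintegral => t _; ring.
  exact: mulr0.
have [lt|gt|eq] := ltngtP (size mu) (size nu).
- case: eqP => [mn|_]; first by rewrite mn ltnn in lt.
  by rewrite -adj_munit omega_adj ?gtlen ?conjC0 //; exact: bnd_munit.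
- by case: eqP => [mn|_]; [rewrite mn ltnn in gt|exact: gtlen].
rewrite eqlen //.
have FU al be : size al = size be -> F (munit al be).
  by move=> ab; apply: (@Fn_UHF (size be)); apply: munit_Fn.
have trU al be : size al = size be -> tr (munit al be : op) = if al == be then tr (munit be be) else 0.
  move=> ab; case: eqP => [-> //|/eqP/negPf nab].
  have h : munit al be = munit al al \o munit al be :> op by rewrite munit_mul // eqxx.
  rewrite h trc; [|exact: FU..].
  by rewrite munit_mul // eq_sym nab tr0.
have trD al be : size al = size be -> tr (munit al al) = tr (munit be be).
  move=> ab; have <- : munit al be \o munit be al = munit al al :> op.
    by rewrite munit_mul // eqxx.
  rewrite trc; [|exact: FU|exact: FU].
  by rewrite munit_mul // eqxx.
rewrite trU // eq; case: eqP => // _.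
have trl_sum (f : 'I_d -> op) : (forall i, F (f i)) -> tr (\sum_i f i) = \sum_i tr (f i).
  move=> hf; suff [//] : tr (\sum_i f i) = \sum_i tr (f i) /\ F (\sum_i f i).
  elim/big_rec2: _ => [|i a b _ [E Fa]]; first by split=> //; apply: (@Fn_UHF 0); apply/FnE; exact: lspan0.
  have := trl 1 _ _ (hf i) Fa; rewrite scale1r mul1r E => ->; split=> //.
  by rewrite -[f i]scale1r; exact: UHF_lin (hf i) Fa.
(* splitting a projection into d equivalent ones divides its trace by d *)
elim/last_ind: (nu) => [|al i IH]; first by rewrite munit_nil tr1 expr0 invr1.
have d0 : d%:R != 0 :> C by rewrite pnatr_eq0; case: (d) i => // -[].
have : tr (munit al al) = d%:R * tr (munit (rcons al i) (rcons al i)).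
  rewrite munit_split trl_sum; last by move=> j; apply: FU; rewrite !size_rcons.
  rewrite (eq_bigr (fun=> tr (munit (rcons al i) (rcons al i)))).
    by rewrite sumr_const card_ord mulr_natl.
  by move=> j _; apply: trD; rewrite !size_rcons.
rewrite IH size_rcons exprS invfM => /(congr1 (fun u : C => d%:R^-1 * u)).
by rewrite mulKf // => <-.
Qed.

End State.

(** * The commutant and the cyclic vector *)

Section Modular.
Variables (K : realType) (d : nat) (G : cuntz_gns K d).
Implicit Types (c : K[i]) (mu nu : seq 'I_d).
Local Notation C := K[i].
Local Notation op := (op G).
Implicit Types (x y z a b : op) (v w : G).
Local Notation S := (cuntzS G).
Local Notation W := (word (cuntzS G)).
Local Notation O := (Cuntz_algebra (cuntzS G)).
Local Notation F := (UHF_algebra (cuntzS G)).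
Local Notation Om := (Omega G).
Local Notation phin n := (iter n (phi G)).

Lemma munit_phin n mu nu al be : size nu = n ->
  munit mu nu \o phin n (munit al be) = munit (mu ++ al) (nu ++ be).
Proof.
move=> hn; rewrite -[LHS]/(W mu \o (adj (W nu) \o phin n _)) (Wa_phin _ hn).
by rewrite /munit W_cat Wa_cat.
Qed.

Lemma omega_prod n m y z : Fn G n y -> Fn G m z ->
  omega (y \o phin n z) = omega y * omega z.
Proof.
move=> hy; move: z; apply: Fn_ind.
- by rewrite phin0 comp0r ?omega0 ?mulr0 //; exact: bnd_Fn hy.
- move=> c z z' _ _ hz hz'; rewrite phin_lin comp_linr; last exact: bnd_Fn hy.
  by rewrite !omega_lin hz hz'; ring.
move=> al be hal hbe; move: y hy; apply: Fn_ind.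
- by rewrite comp0l omega0 mul0r.
- by move=> c z z' _ _ hz hz'; rewrite comp_linl !omega_lin hz hz'; ring.
move=> mu nu hmu hnu; rewrite munit_phin // !omega_munit eqseq_cat ?hmu ?hnu //.
case: eqP => _ /=; last by rewrite mul0r.
case: eqP => _ /=; last by rewrite mulr0.
by rewrite size_cat hmu exprD invfM.
Qed.

Lemma omega_id : omega (idfun : op) = 1.
Proof. by rewrite -munit_nil omega_munit eqxx expr0 invr1. Qed.

Lemma omegaC n x y : Fn G n x -> Fn G n y -> omega (x \o y) = omega (y \o x).
Proof.
move=> hx; move: y; apply: Fn_ind.
- by rewrite comp0r //; exact: bnd_Fn hx.
- by move=> c y z _ _ hy hz; rewrite comp_linl comp_linr ?omega_lin ?hy ?hz //; exact: bnd_Fn hx.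
move=> mu nu hmu hnu; move: x hx; apply: Fn_ind.
- by rewrite comp0r //; exact: bnd_munit.
- by move=> c y z _ _ hy hz; rewrite comp_linl comp_linr ?omega_lin ?hy ?hz //; exact: bnd_munit.
move=> al be hal hbe; rewrite !munit_mul ?hmu ?hnu //.
have E (b : bool) p q : omega (if b then munit p q else 0 : op) =
    if b && (p == q) then (d%:R ^+ size p)^-1 else 0.
  by case: b; rewrite ?omega_munit ?omega0.
by rewrite !E andbC [be == mu]eq_sym [nu == al]eq_sym hal hmu.
Qed.

(** The failure of the trace property on the generators is only a factor [d]:
    this is the KMS condition for the gauge action. It makes right
    multiplication by a generator bounded on the vectors [a Om]. *)
Lemma omega_KMS b i : cpoly b -> omega (b \o S i) = d%:R * omega (S i \o b).
Proof.
have d0 : d%:R != 0 :> C by rewrite pnatr_eq0; case: (d) i => // -[].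
move=> /cpoly_munit; elim=> [|c _ z [mu [nu ->]] _ IH].
  by rewrite comp0l comp0r ?omega0 ?mulr0 //; exact: bnd_S.
rewrite comp_linl comp_linr; last exact: bnd_S.
rewrite !omega_lin IH mulrDr; congr (_ + _); rewrite mulrCA; congr (_ * _).
rewrite -[S i \o munit mu nu]/(munit (i :: mu) nu).
case: nu => [|j nu].
  have -> : munit mu [::] \o S i = munit (rcons mu i) [::] :> op.
    rewrite /munit -cats1 W_cat /= adj_id; exact/funext.
  by rewrite !omega_munit; case: mu => [|k mu] /=; rewrite mulr0.
have -> : munit mu (j :: nu) \o S i = (if j == i then munit mu nu else 0) :> op.
  rewrite /munit Wa_cons; apply/funext => v /=; rewrite SaS.
  by case: eqP => // _; rewrite (bop0 (bnd_Wa _ _)) (bop0 (bnd_W _ _)).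
rewrite omega_munit eqseq_cons [i == j]eq_sym; case: eqP => _ /=; last by rewrite omega0 mulr0.
rewrite omega_munit; case: eqP => _; last by rewrite mulr0.
by rewrite exprS invfM mulVKf.
Qed.

Lemma omega_sq a v : bounded_op a -> ip G (adj a (a v)) v = (nm (a v) ^+ 2)%:C%C.
Proof. by move=> ba; rewrite ip_adjl // ip_nm. Qed.

Lemma omega_sqE a : bounded_op a -> omega (adj a \o a) = (nm (a Om) ^+ 2)%:C%C.
Proof. exact: omega_sq. Qed.

(** Summation over the generators turns [omega_KMS] into an equality of norms,
    because the range projections add up to 1. *)
Lemma nm_S_sum a : cpoly a -> \sum_(i < d) nm (a (S i Om)) ^+ 2 = d%:R * nm (a Om) ^+ 2.
Proof.
move=> ca; have ba := bnd_cpoly ca.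
apply: (@complexI K); rewrite rmorph_sum rmorphM rmorph_nat /= -omega_sqE //.
have -> : adj a \o a = \sum_(i < d) (S i \o adj (S i)) \o (adj a \o a).
  by have [_ _ ->] := cuntzP G.
rewrite comp_suml omega_sum mulr_sumr; apply: eq_bigr => i _.
rewrite -[X in omega X]/(S i \o (adj (S i) \o (adj a \o a))) -omega_KMS; last first.
  exact: cpoly_comp (cpoly_adj (cpoly_S G i)) (cpoly_comp (cpoly_adj ca) ca).
by rewrite /omega /= (ip_adjl (bnd_S G i)) omega_sq.
Qed.

Lemma nm_Sa a i : cpoly a -> nm (a (adj (S i) Om)) ^+ 2 = d%:R^-1 * nm (a Om) ^+ 2.
Proof.
have d0 : d%:R != 0 :> C by rewrite pnatr_eq0; case: (d) i => // -[].
move=> ca; have ba := bnd_cpoly ca.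
apply: (@complexI K); rewrite [RHS]rmorphM fmorphV rmorph_nat /= -omega_sqE // -omega_sq //.
have := @omega_KMS (adj a \o a \o adj (S i)) i.
have -> : (adj a \o a \o adj (S i)) \o S i = adj a \o a.
  by apply/funext => v /=; rewrite SaS eqxx.
move=> ->; last exact: cpoly_comp (cpoly_comp (cpoly_adj ca) ca) (cpoly_adj (cpoly_S G i)).
by rewrite mulKf // /omega /= (ip_adjr (bnd_S G i)).
Qed.

(** Right multiplication by [m] commutes with all left multiplications, so it
    provides elements of the commutant. *)
Definition right_multiplier m := exists2 T, bounded_op T &
  forall a, cpoly a -> T (a Om) = a (m Om).

Lemma right_multiplier_bound m (M : K) : 0 <= M -> bounded_op m ->
  (forall a, cpoly a -> nm (a (m Om)) <= M * nm (a Om)) -> right_multiplier m.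
Proof.
move=> M0 bm hM.
have [||||T [bT hT _]] := @extend_op K G (fun u v => exists a, [/\ cpoly a, u = a Om & v = a (m Om)]) M.
- by [].
- move=> c _ _ _ _ [a [ca -> ->]] [b [cb -> ->]]; exists (c *: a + b).
  by split=> //; exact: cpoly_lin.
- by move=> _ _ [a [ca -> ->]]; exact: hM.
- move=> v e /(cpoly_dense v)[_ [a ca <-] h]; exists (a Om), (a (m Om)); split=> //.
  by exists a.
by exists T => // a ca; apply: hT; exists a.
Qed.

Lemma right_multiplier_S i : right_multiplier (S i).
Proof.
have d1 : 1 <= d%:R :> K by rewrite ler1n; case: (d) i => // -[].
apply: (@right_multiplier_bound _ d%:R); [by rewrite ler0n|exact: bnd_S|].
move=> a ca; rewrite -(ler_pXn2r (n := 2)) ?nnegrE ?mulr_ge0 ?nm_ge0 ?ler0n //.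
rewrite exprMn; apply: (@le_trans _ _ (d%:R * nm (a Om) ^+ 2)); last first.
  by rewrite ler_wpM2r ?exprn_ge0 ?nm_ge0 // expr2 ler_peMr // ler0n.
rewrite -nm_S_sum // (bigD1 i) //= lerDl; apply: sumr_ge0 => j _.
by rewrite exprn_ge0 // nm_ge0.
Qed.

Lemma right_multiplier_Sa i : right_multiplier (adj (S i)).
Proof.
have d1 : 1 <= d%:R :> K by rewrite ler1n; case: (d) i => // -[].
apply: (@right_multiplier_bound _ 1); [exact: ler01|exact: bnd_Sa|].
move=> a ca; rewrite -(ler_pXn2r (n := 2)) ?nnegrE ?mulr_ge0 ?nm_ge0 //.
rewrite nm_Sa // mul1r ler_piMl ?exprn_ge0 ?nm_ge0 //.
by rewrite invf_le1 // (lt_le_trans ltr01).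
Qed.

Lemma right_multiplier_comp m m' : cpoly m ->
  right_multiplier m -> right_multiplier m' -> right_multiplier (m \o m').
Proof.
move=> cm [T bT hT] [T' bT' hT']; exists (T' \o T); first exact: bnd_comp.
move=> a ca /=; rewrite hT //; exact: (hT' (a \o m) (cpoly_comp ca cm)).
Qed.

Lemma right_multiplier_W mu : right_multiplier (W mu).
Proof.
elim: mu => [|i mu IH]; first by exists idfun; [exact: bnd_id|].
exact: right_multiplier_comp (cpoly_S _ _) (right_multiplier_S i) IH.
Qed.

Lemma cpoly_Wa mu : cpoly (adj (W mu)).
Proof. by rewrite (_ : adj (W mu) = munit [::] mu); [exact: munit_cpoly|]. Qed.

Lemma cpoly_W mu : cpoly (W mu).
Proof. by rewrite (_ : W mu = munit mu [::]); [exact: munit_cpoly|rewrite /munit /= adj_id]. Qed.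

Lemma right_multiplier_Wa mu : right_multiplier (adj (W mu)).
Proof.
elim: mu => [|i mu IH]; first by rewrite /= adj_id; exists idfun; [exact: bnd_id|].
rewrite Wa_cons; apply: right_multiplier_comp IH (right_multiplier_Sa i).
exact: cpoly_Wa.
Qed.

Lemma right_multiplier_cpoly m : cpoly m -> right_multiplier m.
Proof.
move=> /cpoly_munit; elim=> [|c _ b [mu [nu ->]] _ [T bT hT]].
  by exists 0; [exact: bnd0|move=> a ca; rewrite (bop0 (bnd_cpoly ca))].
have [T' bT' hT'] := right_multiplier_comp (cpoly_W _) (right_multiplier_W mu) (right_multiplier_Wa nu).
exists (c *: T' + T); first exact: bnd_lin.
by move=> a ca; rewrite !fctE hT // hT' // (bopP (bnd_cpoly ca)).
Qed.

(** The cyclic vector is cyclic for the commutant as well. *)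
Lemma commutant_Omega m : cpoly m -> exists2 T, commutant O T & T Om = m Om.
Proof.
move=> cm; have [T bT hT] := right_multiplier_cpoly cm.
exists T; last exact: (hT _ (cpoly_id G)).
apply: (comm_sub (Cuntz_sub_closure (G := G))); apply: comm_norm_closure; first exact: bnd_cpoly.
split=> // b cb; have bb := bnd_cpoly cb.
apply: (bop_dense (D := [set x Om | x in cpoly (G := G)])); [exact: bnd_comp..| |].
  exact: cpoly_dense.
by move=> _ [a ca <-] /=; rewrite hT // -[b (a Om)]/((b \o a) Om) hT //; exact: cpoly_comp.
Qed.

Lemma commutant_O_F : commutant O `<=` commutant F.
Proof. exact: comm_sub (UHF_sub_Cuntz (G := G)). Qed.

Lemma Nvn_Mvn : Nvn G `<=` Mvn G.
Proof. exact: vN_sub (UHF_sub_Cuntz (G := G)). Qed.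

Lemma Mvn_bnd : Mvn G `<=` @bounded_op K G.
Proof. exact: vN_bnd. Qed.

Lemma Nvn_bnd : Nvn G `<=` @bounded_op K G.
Proof. exact: vN_bnd. Qed.

(** An element of the algebra which kills the vector kills the orbit of this
    vector under the commutant. *)
Lemma Mvn_separating x : Mvn G x -> x Om = 0 -> x = 0.
Proof.
move=> hx x0; apply: (bop_dense (D := [set x Om | x in cpoly (G := G)])).
- exact: Mvn_bnd.
- exact: bnd0.
- exact: cpoly_dense.
move=> _ [a ca <-]; have [T hT <-] := commutant_Omega ca.
have [_ /(_ T hT) /(congr1 (@^~ Om)) /= <-] := hx.
rewrite x0; exact: bop0 hT.1.
Qed.

(** A complement of the degree 0 part in [cpoly], orthogonal to it at [Om]. *)
Definition offdiag : set op := lspan [set x | exists2 k : int, k != 0 & homog k x].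

Lemma homog0_offdiag a b : homog 0 a -> offdiag b -> offdiag (a \o b).
Proof.
move=> ha; apply: lspan_comp_l; first exact: bnd_homog ha.
move=> b' [k k0 hb]; apply: lspan_gen; exists k => //.
by rewrite -[k]add0r; exact: homog_comp.
Qed.

Lemma omega_offdiag b : offdiag b -> omega b = 0.
Proof.
elim=> [|c b' z [k k0 hb] _ IH]; first exact: omega0.
rewrite omega_lin IH addr0.
suff -> : omega b' = 0 by rewrite mulr0.
elim: hb => [|k' _ z' [mu [nu [h ->]]] _ IH']; first exact: omega0.
rewrite omega_lin IH' addr0 omega_munit; case: eqP => [mn|_]; last by rewrite mulr0.
by move: k0; rewrite -h mn subrr eqxx.
Qed.

Lemma cpoly_decomp x : cpoly x -> exists a b, [/\ homog 0 a, offdiag b & x = a + b].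
Proof.
elim=> [|c y z [k hy] _ [a [b [ha hb ->]]]].
  by exists 0, 0; split; [exact: lspan0|exact: lspan0|rewrite addr0].
have [k0|k0] := eqVneq k 0.
  exists (c *: y + a), b; split=> //; last by rewrite addrA.
  by apply: lspan_lin => //; rewrite -k0.
exists a, (c *: y + b); split=> //; last by rewrite addrCA.
by apply: lspan_lin => //; apply: lspan_gen; exists k.
Qed.

Lemma homog0_offdiag_orth a b : homog 0 a -> offdiag b -> ip G (a Om) (b Om) = 0.
Proof.
move=> ha hb; have ba := bnd_homog ha; rewrite ipC.
have -> : ip G (b Om) (a Om) = omega (adj a \o b) by rewrite /omega /= ip_adjl.
rewrite omega_offdiag ?conjC0 //; apply: homog0_offdiag => //.
by rewrite -oppr0; exact: homog_adj.
Qed.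

(** The projection onto the closure of [F Om] along the other gauge degrees is
    bounded by orthogonality and commutes with [F], hence with [x]; it fixes
    [Om], hence also [x Om]. *)
Lemma Nvn_dense x (e : K) : Nvn G x -> 0 < e ->
  exists n a, Fn G n a /\ nm (x Om - a Om) < e.
Proof.
move=> hx e0.
pose Gr (u v : G) := exists a b, [/\ homog 0 a, offdiag b, u = a Om + b Om & v = a Om].
have [||||T [bT hT aT]] := @extend_op K G Gr 1.
- exact: ler01.
- move=> c _ _ _ _ [a [b [ha hb -> ->]]] [a' [b' [ha' hb' -> ->]]].
  exists (c *: a + a'), (c *: b + b'); split=> //; try exact: lspan_lin.
  by rewrite !fctE scalerDr addrACA.
- move=> _ _ [a [b [ha hb -> ->]]]; rewrite mul1r.
  rewrite -(ler_pXn2r (n := 2)) ?nnegrE ?nm_ge0 //.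
  rewrite nmD2 /rip homog0_offdiag_orth //= mulr0 addr0 lerDl.
  by rewrite exprn_ge0 // nm_ge0.
- move=> v e' /(cpoly_dense v)[_ [y /cpoly_decomp[a [b [ha hb ->]]] <-] h].
  by exists (a Om + b Om), (a Om); split=> //; exists a, b.
have cT : commutant F T.
  apply: comm_norm_closure; first by move=> y [n _]; exact: bnd_Fn.
  split=> // f [n _ hf]; have bf := bnd_Fn hf; have hf0 := Fn_homog hf.
  apply: (bop_dense (D := [set x Om | x in cpoly (G := G)])); [exact: bnd_comp..| |].
    exact: cpoly_dense.
  move=> _ [y /cpoly_decomp[a [b [ha hb ->]]] <-] /=.
  have -> : T ((a + b) Om) = a Om by apply: hT; exists a, b.
  rewrite [(a + b) Om]/(a Om + b Om) (bopD bf); apply/esym; apply: hT.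
  exists (f \o a), (f \o b); split=> //; last exact: homog0_offdiag.
  by rewrite -[0]addr0; exact: homog_comp.
have TOm : T Om = Om.
  apply: hT; exists idfun, 0; split; rewrite ?addr0 //; last exact: lspan0.
  exact: Fn_homog (Fn_id G 0).
have TxOm : T (x Om) = x Om.
  by have [_ /(_ T cT) /(congr1 (@^~ Om)) /= ->] := hx; rewrite TOm.
have [_ [_ [[a [b [/homog_Fn[n ha] _ _ ->]]] _]]] := aT (x Om) e e0.
by rewrite TxOm => h; exists n, a.
Qed.

(** A uniformly bounded family whose values at [Om] approach [v] converges on
    all vectors [r Om] with [r] in the commutant, to [r v]. The limit operator
    [r Om |-> r v] commutes with the commutant. *)
Lemma Nvn_limit (M : K) v : 0 <= M ->
  (forall e : K, 0 < e -> exists b, [/\ Nvn G b, forall w, nm (b w) <= M * nm w & nm (b Om - v) < e]) ->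
  exists2 a, Nvn G a & a Om = v.
Proof.
move=> M0 hv; pose Gr (u w : G) := exists r, [/\ commutant F r, u = r Om & w = r v].
have dens u (e : K) : 0 < e -> exists2 r, commutant F r & nm (u - r Om) < e.
  move=> /(cpoly_dense u)[_ [m /commutant_Omega[r cr <-] <-] h].
  by exists r => //; exact: commutant_O_F.
have [||||T [bT hT _]] := @extend_op K G Gr M.
- by [].
- move=> c _ _ _ _ [r [cr -> ->]] [r' [cr' -> ->]]; exists (c *: r + r'); split=> //.
  by apply: comm_lin => //; exact: UHF_bnd.
- move=> _ _ [r [cr -> ->]]; have [N N0 hN] := bop_le cr.1.
  have N1 : 0 < N + 1 by rewrite ltr_wpDl.
  apply: le_eps => e e0; have [b [hb bM hbv]] := hv _ (divr_gt0 e0 N1).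
  have E : b (r Om) = r (b Om) by have [_ /(_ r cr) /(congr1 (@^~ Om))] := hb.
  have h1 := bM (r Om); rewrite E in h1.
  have h2 : nm (r v - r (b Om)) <= e.
    rewrite -(bopB cr.1); apply: le_trans (hN _) _.
    apply: (@le_trans _ _ ((N + 1) * nm (v - b Om))).
      by rewrite ler_wpM2r ?nm_ge0 // lerDl.
    by rewrite nmBC mulrC -ler_pdivlMr // ltW.
  have := nmB_trans (r (b Om)) (r v) 0; rewrite !subr0; lra.
- move=> u e /(dens u)[r cr h]; exists (r Om), (r v); split=> //; by exists r.
exists T; last by apply: hT; exists idfun; split=> //; exact: comm_id.
split=> // r' cr'; apply: (bop_dense (D := [set r Om | r in commutant F])).
- exact: bnd_comp bT cr'.1 || exact: bnd_comp cr'.1 bT.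
- exact: bnd_comp bT cr'.1 || exact: bnd_comp cr'.1 bT.
- by move=> u e /(dens u)[r cr h]; exists (r Om) => //; exists r.
move=> _ [r cr <-] /=; have -> : T (r Om) = r v by apply: hT; exists r.
have -> : T (r' (r Om)) = r' (r v); last by [].
by apply: hT; exists (r' \o r); split=> //; exact: comm_comp.
Qed.

End Modular.

(** * Endomorphisms as inner maps on the levels of the tower *)

Section Unitaries.
Variables (K : realType) (H : hilbert K).
Local Notation op := (op H).
Implicit Types (u v x : op).

Definition unitary_op u := [/\ bounded_op u, adj u \o u = idfun & u \o adj u = idfun].

Lemma unitary_bnd u : unitary_op u -> bounded_op u. Proof. by case. Qed.

Lemma unitary_id : unitary_op idfun.
Proof. by split; rewrite ?adj_id //; exact: bnd_id. Qed.

Lemma unitary_adj u : unitary_op u -> unitary_op (adj u).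
Proof. by move=> [b h h']; split; rewrite ?adjK //; exact: bnd_adj. Qed.

Lemma unitary_comp u v : unitary_op u -> unitary_op v -> unitary_op (u \o v).
Proof.
move=> [bu hu hu'] [bv hv hv']; split; first exact: bnd_comp.
  rewrite (adj_comp bu bv) -[LHS]/(adj v \o (adj u \o u) \o v) hu; exact: hv.
rewrite (adj_comp bu bv) -[LHS]/(u \o (v \o adj v) \o adj u) hv'; exact: hu'.
Qed.

Lemma unitary_nm u w : unitary_op u -> nm (u w) = nm w.
Proof.
move=> [bu hu _]; apply/eqP; rewrite -(eqrXn2 (n := 2)) ?nm_ge0 //; apply/eqP.
apply: (@complexI K); rewrite -!ip_nm -ip_adjr //.
by rewrite -[adj u (u w)]/((adj u \o u) w) hu.
Qed.

End Unitaries.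

Section Endo.
Variables (K : realType) (d : nat) (G : cuntz_gns K d).
Implicit Types (c : K[i]) (mu nu : seq 'I_d).
Local Notation C := K[i].
Local Notation op := (op G).
Implicit Types (x y z a b u v : op) (f : op -> op).
Local Notation S := (cuntzS G).
Local Notation W := (word (cuntzS G)).
Local Notation O := (Cuntz_algebra (cuntzS G)).
Local Notation F := (UHF_algebra (cuntzS G)).
Local Notation Om := (Omega G).
Local Notation phi := (phi G).
Local Notation phin n := (iter n phi).

Lemma unitary_phin n u : unitary_op u -> unitary_op (phin n u).
Proof.
move=> [bu h h']; split; first exact: bnd_phin.
  by rewrite -phin_adj // -phin_comp ?h ?phin_id //; exact: bnd_adj.
by rewrite -phin_adj // -phin_comp ?h' ?phin_id.
Qed.

(** The part of the structure of an extended endomorphism which passes to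
    iterates. *)
Record endo u f : Prop := Endo {
  endo_unitary : unitary_op u;
  endo_hom : star_hom (Mvn G) f;
  endo_M : forall x, Mvn G x -> Mvn G (f x);
  endo_S : forall i, f (S i) = u \o S i;
  endo_omega : forall x, Mvn G x -> omega (f x) = omega x }.

Lemma lambda_endo u f : unitary_op u -> lambda_ext u f -> endo u f.
Proof. by move=> hu [h1 h2 _ h3 h4 _]; split. Qed.

Lemma Mvn_lin c x y : Mvn G x -> Mvn G y -> Mvn G (c *: x + y).
Proof. exact: vN_lin. Qed.

Lemma Mvn_comp x y : Mvn G x -> Mvn G y -> Mvn G (x \o y).
Proof. exact: vN_comp. Qed.

Lemma Mvn_adj x : Mvn G x -> Mvn G (adj x).
Proof. by apply: vN_adj; [exact: Cuntz_bnd|exact: Cuntz_adj]. Qed.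

Lemma Nvn_lin c x y : Nvn G x -> Nvn G y -> Nvn G (c *: x + y).
Proof. exact: vN_lin. Qed.

Lemma Nvn_comp x y : Nvn G x -> Nvn G y -> Nvn G (x \o y).
Proof. exact: vN_comp. Qed.

Lemma Nvn_id : Nvn G idfun.
Proof. exact: vN_id. Qed.

Lemma Nvn_adj x : Nvn G x -> Nvn G (adj x).
Proof. by apply: vN_adj; [exact: UHF_bnd|exact: UHF_adj]. Qed.

Lemma Cuntz_Mvn : O `<=` Mvn G.
Proof. by apply: sub_vN; exact: Cuntz_bnd. Qed.

Lemma Fn_Nvn n : Fn G n `<=` Nvn G.
Proof. by move=> x /Fn_UHF; apply: sub_vN; exact: UHF_bnd. Qed.

Lemma Fn_Mvn n : Fn G n `<=` Mvn G.
Proof. by move=> x /Fn_Nvn; exact: Nvn_Mvn. Qed.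

Section EndoTheory.
Variables (u : op) (f : op -> op).
Hypothesis hf : endo u f.

Lemma endo_lin c x y : Mvn G x -> Mvn G y -> f (c *: x + y) = c *: f x + f y.
Proof. exact: (hom_lin (endo_hom hf)). Qed.

Lemma endo_comp x y : Mvn G x -> Mvn G y -> f (x \o y) = f x \o f y.
Proof. exact: (hom_mul (endo_hom hf)). Qed.

Lemma endo_adj x : Mvn G x -> f (adj x) = adj (f x).
Proof. exact: (hom_adj (endo_hom hf)). Qed.

Lemma endo_id : f idfun = idfun.
Proof. exact: (hom_one (endo_hom hf)). Qed.

Lemma endo0 : f 0 = 0.
Proof.
have h := Mvn_comp (Fn_Mvn (Fn_id G 0)) (Fn_Mvn (Fn_id G 0)).
by have := endo_lin (-1) h h; rewrite scaleN1r addNr scaleN1r addNr.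
Qed.

(** The endomorphism preserves the state of [adj x \o x]; so it acts on
    [M Om] as an isometry, and estimates at [Om] are transported by it. *)
Lemma endo_nm x : Mvn G x -> nm (f x Om) = nm (x Om).
Proof.
move=> hx; apply/eqP; rewrite -(eqrXn2 (n := 2)) ?nm_ge0 //; apply/eqP.
apply: (@complexI K); have hfx := endo_M hf hx.
rewrite -!omega_sqE; [|exact: Mvn_bnd..].
rewrite -endo_adj // -endo_comp //; last exact: Mvn_adj.
by rewrite (endo_omega hf) //; apply: Mvn_comp => //; exact: Mvn_adj.
Qed.

Lemma endo_nmB x y : Mvn G x -> Mvn G y -> nm (f x Om - f y Om) = nm (x Om - y Om).
Proof.
move=> hx hy; have := endo_nm (Mvn_lin (-1) hy hx).
by rewrite endo_lin // !fctE !scaleN1r ![- _ + _]addrC.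
Qed.

(** [v phi(v) ... phi^(n-1)(v)], the unitary which implements on level [n] the
    endomorphism sending each generator [S i] to [v \o S i]. *)
Fixpoint cocycle (v : op) (n : nat) : op :=
  if n is m.+1 then v \o phi (cocycle v m) else idfun.

Lemma unitary_cocycle v n : unitary_op v -> unitary_op (cocycle v n).
Proof.
move=> hv; elim: n => [|n IH]; first exact: unitary_id.
exact: unitary_comp hv (unitary_phin 1 IH).
Qed.

Lemma cocycle_add v m k : unitary_op v ->
  cocycle v (m + k) = cocycle v m \o phin m (cocycle v k).
Proof.
move=> hv; elim: m => // m IH.
rewrite addSn [LHS]/= IH phi_comp //; exact: unitary_bnd (unitary_cocycle m hv).
Qed.

Lemma cocycle1 v : cocycle v 1 = v.
Proof. by rewrite /= phi_id. Qed.

Lemma cocycleS v n : unitary_op v -> cocycle v n.+1 = cocycle v n \o phin n v.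
Proof. by move=> hv; rewrite -addn1 cocycle_add // cocycle1. Qed.

Lemma endo_W mu : f (W mu) = cocycle u (size mu) \o W mu.
Proof.
elim: mu => [|i mu IH]; first exact: endo_id.
rewrite [W _]/= endo_comp; [|exact: Cuntz_Mvn (Cuntz_S _)|exact: Cuntz_Mvn (Cuntz_W _)].
have bc := unitary_bnd (unitary_cocycle (size mu) (endo_unitary hf)).
rewrite IH (endo_S hf) -[LHS]/(u \o (S i \o cocycle u (size mu)) \o W mu).
by rewrite -(phi_S i bc).
Qed.

Lemma endo_Fn n x : Fn G n x -> f x = cocycle u n \o x \o adj (cocycle u n).
Proof.
have bc m := unitary_bnd (unitary_cocycle m (endo_unitary hf)).
move: x; apply: Fn_ind.
- by rewrite endo0 comp0r // comp0l.
- move=> c x y hx hy h h'; rewrite endo_lin ?h ?h'; [|exact: Fn_Mvn hx|exact: Fn_Mvn hy].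
  by rewrite comp_linr // comp_linl.
move=> mu nu hm hn.
have MW al : Mvn G (W al) := Cuntz_Mvn (Cuntz_W al).
rewrite endo_comp //; last exact: Mvn_adj.
rewrite endo_adj // !endo_W hm hn (adj_comp (bc n) (bnd_W _ nu)).
by apply/funext.
Qed.

End EndoTheory.

Lemma Fn_cocycle v k n : unitary_op v -> Fn G k.+1 v -> Fn G (k + n) (cocycle v n).
Proof.
move=> hv Fv; elim: n => [|n IH]; first exact: Fn_id.
rewrite cocycleS // addnS; apply: Fn_comp; first exact: Fn_S IH.
by rewrite -addSn addnC; exact: Fn_phin.
Qed.

(** Composition law [lambda_u lambda_u' = lambda_(lambda_u(u') u)]. *)
Lemma endo_comp_endo u f u' f' : endo u f -> endo u' f' -> Mvn G u' ->
  endo (f u' \o u) (f \o f').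
Proof.
move=> hf hf' Mu'; split.
- apply: unitary_comp (endo_unitary hf); have [bu h h'] := endo_unitary hf'.
  split; first exact: Mvn_bnd (endo_M hf Mu').
    by rewrite -(endo_adj hf) // -(endo_comp hf) ?h ?(endo_id hf) //; exact: Mvn_adj.
  by rewrite -(endo_adj hf) // -(endo_comp hf) ?h' ?(endo_id hf) //; exact: Mvn_adj.
- split=> [c a b ha hb|a b ha hb||a ha] /=.
  + by rewrite (endo_lin hf') // (endo_lin hf) //; exact: (endo_M hf').
  + by rewrite (endo_comp hf') // (endo_comp hf) //; exact: (endo_M hf').
  + by rewrite (endo_id hf') (endo_id hf).
  + by rewrite (endo_adj hf') // (endo_adj hf) //; exact: (endo_M hf').
- by move=> x hx; apply: (endo_M hf); exact: (endo_M hf').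
- move=> i /=; rewrite (endo_S hf') (endo_comp hf) ?(endo_S hf) //.
  exact: Cuntz_Mvn (Cuntz_S _).
- by move=> x hx /=; rewrite (endo_omega hf) ?(endo_omega hf') //; exact: (endo_M hf').
Qed.

Section YangBaxter.
Variables (R : op) (lam : op -> op).
Hypotheses (hR : Rmatrix R) (hl : endo R lam).

Let uR : unitary_op R := endo_unitary hl.
Let FR : Fn G 2 R. Proof. by have [[]] := hR. Qed.

Lemma lam_Fn n x : Fn G n x -> Fn G n.+1 (lam x).
Proof.
move=> hx; rewrite (endo_Fn hl hx); have hc := Fn_cocycle n uR FR.
by apply: Fn_comp; [apply: Fn_comp => //; exact: Fn_S|exact: Fn_adj].
Qed.

(** The Yang-Baxter equation in the form [lambda_R(R) = phi(R)], moved along the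
    tensor factors: the part of the cocycle before position [k] commutes with
    [phin k.+1 R], and the part after position [k+1] is absent on this level. *)
Lemma lam_shift k : lam (phin k R) = phin k.+1 R.
Proof.
have FkR : Fn G (k + 2) (phin k R) := Fn_phin k FR.
rewrite (endo_Fn hl FkR) cocycle_add //.
have [_ ybe] := hR; have [bR R1 R2] := uR.
have bphi := bnd_phi bR.
set c := cocycle R k; have [bc c1 c2] : unitary_op c := unitary_cocycle k uR.
have E2 : cocycle R 2 = R \o phi R by rewrite /= phi_id.
have b2 : bounded_op (cocycle R 2) := unitary_bnd (unitary_cocycle 2 uR).
rewrite (adj_comp bc (bnd_phin _ b2)) -(phin_adj _ b2).
rewrite -[LHS]/(c \o ((phin k (cocycle R 2) \o phin k R) \o phin k (adj (cocycle R 2))) \o adj c).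
rewrite -(phin_comp _ _ b2) -phin_comp; last exact: bnd_comp.
have -> : cocycle R 2 \o R \o adj (cocycle R 2) = phi R.
  rewrite E2 (adj_comp bR bphi) -[LHS]/((R \o phi R \o R) \o (adj (phi R) \o adj R)) ybe.
  have [_ _ p2] := unitary_phin 1 uR.
  rewrite -[LHS]/(phi R \o (R \o (phi R \o adj (phi R)) \o adj R)) [phi R \o adj _]p2.
  by rewrite -[LHS]/(phi R \o (R \o adj R)) R2.
have Fc : Fn G k.+1 c := Fn_cocycle k uR FR.
rewrite -iterSr (Fn_commute bR Fc).
by rewrite -[LHS]/(phin k.+1 R \o (c \o adj c)) c2.
Qed.

(** The elements on which the endomorphism coincides with the shift; they
    contain everything built from [R] by products and shifts. *)
Definition shifted x := (exists n, Fn G n x) /\ forall j, lam (phin j x) = phin j.+1 x.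

Lemma shifted_R : shifted R.
Proof. by split; [exists 2|exact: lam_shift]. Qed.

Lemma shifted_id : shifted idfun.
Proof. by split=> [|j]; [exists 0%N; exact: Fn_id|rewrite !phin_id (endo_id hl)]. Qed.

Lemma shifted_comp x y : shifted x -> shifted y -> shifted (x \o y).
Proof.
move=> [[n hx] lx] [[m hy] ly]; have bx := bnd_Fn hx; split.
  exists (maxn n m); apply: Fn_comp; [exact: Fn_le (leq_maxl _ _) hx|exact: Fn_le (leq_maxr _ _) hy].
move=> j; rewrite (phin_comp j _ bx) (phin_comp j.+1 _ bx) (endo_comp hl) ?lx ?ly //.
  exact: Fn_Mvn (Fn_phin j hx).
exact: Fn_Mvn (Fn_phin j hy).
Qed.

Lemma shifted_phi x : shifted x -> shifted (phi x).
Proof.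
move=> [[n hx] lx]; split; first by exists n.+1; exact: Fn_phi.
by move=> j; rewrite -!iterSr; exact: lx.
Qed.

Lemma shifted_phin n x : shifted x -> shifted (phin n x).
Proof. by move=> hx; elim: n => // n; exact: shifted_phi. Qed.

Lemma shifted_iter n x : shifted x -> iter n lam x = phin n x.
Proof. by move=> [_ h]; elim: n => // n IH; rewrite iterS IH h. Qed.

Lemma nRS n : nR n.+1 R = phin n R \o nR n R.
Proof. by rewrite /nR -addn1 iotaD cats1 rev_rcons big_cons. Qed.

Lemma nRSr n : nR n.+1 R = phi (nR n R) \o R.
Proof.
elim: n => [|n IH]; first by rewrite nRS /nR /= big_nil phi_id.
rewrite nRS {1}IH nRS (phi_comp _ (bnd_phin n (unitary_bnd uR))).
by [].
Qed.

Lemma nR0 : nR 0 R = idfun.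
Proof. by rewrite /nR big_nil. Qed.

Lemma Fn_nR n : Fn G n.+1 (nR n R).
Proof.
elim: n => [|n IH]; first by rewrite nR0; exact: Fn_id.
rewrite nRS; apply: Fn_comp; last exact: Fn_S.
by rewrite -addn2; exact: Fn_phin.
Qed.

Lemma shifted_nR n : shifted (nR n R).
Proof.
elim: n => [|n IH]; first by rewrite nR0; exact: shifted_id.
by rewrite nRS; apply: shifted_comp => //; apply: shifted_phin; exact: shifted_R.
Qed.

Lemma unitary_nR n : unitary_op (nR n R).
Proof.
elim: n => [|n IH]; first by rewrite nR0; exact: unitary_id.
by rewrite nRS; apply: unitary_comp => //; exact: unitary_phin.
Qed.

(** The iterates of [lambda_R] are the endomorphisms attached to the unitaries
    [nR n R], because [lambda_R] shifts [nR n R]. *)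
Lemma iter_endo n : endo (nR n R) (iter n lam).
Proof.
elim: n => [|n IH].
  rewrite nR0; split=> //; exact: unitary_id.
have -> : nR n.+1 R = lam (nR n R) \o R.
  by rewrite nRSr; have [_ /(_ 0%N) /= ->] := shifted_nR n.
by apply: (endo_comp_endo hl IH); exact: Fn_Mvn (Fn_nR n).
Qed.

Lemma big_phin v m : unitary_op v ->
  \big[comp/idfun]_(k <- iota 0 m) phin k v = cocycle v m.
Proof.
move=> hv; elim: m => [|m IH]; first by rewrite big_nil.
rewrite [iota _ _]/= big_cons /= -IH -[1%N]addn0 iotaDl big_map; congr (_ \o _).
elim: (iota 0 m) => [|k s IHs]; first by rewrite !big_nil phi_id.
by rewrite !big_cons IHs phi_comp //; exact: bnd_phin (unitary_bnd hv).
Qed.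

Lemma nRnE n : nRn n R = cocycle (nR n R) n.
Proof. exact: big_phin (unitary_nR n). Qed.

Lemma Fn_nRn n : Fn G (n + n) (nRn n R).
Proof. by rewrite nRnE; apply: Fn_cocycle; [exact: unitary_nR|exact: Fn_nR]. Qed.

Lemma unitary_nRn n : unitary_op (nRn n R).
Proof. by rewrite nRnE; apply: unitary_cocycle; exact: unitary_nR. Qed.

Lemma shifted_nRn n : shifted (nRn n R).
Proof.
rewrite nRnE; move: {2}n => m; elim: m => [|m IH]; first exact: shifted_id.
rewrite /= ; apply: shifted_comp; [exact: shifted_nR|exact: shifted_phi].
Qed.

Lemma iter_lam_nRn n x : Fn G n x -> iter n lam x = nRn n R \o x \o adj (nRn n R).
Proof. by move=> hx; rewrite (endo_Fn (iter_endo n) hx) nRnE. Qed.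

(** [lambda_R^n] acts on level [2n] as conjugation by [U phi^n(U)], where
    [U = nRn n R], and it shifts [U] by [n] places. Comparing both values at [U]
    gives the Yang-Baxter equation for the blocks. *)
Lemma nRn_ybe n : nRn n R \o phin n (nRn n R) \o nRn n R =
  phin n (nRn n R) \o nRn n R \o phin n (nRn n R).
Proof.
set U := nRn n R; have [bU U1 U2] : unitary_op U := unitary_nRn n.
have [bp p1 p2] : unitary_op (phin n U) := unitary_phin n (unitary_nRn n).
have := shifted_iter n (shifted_nRn n); rewrite (endo_Fn (iter_endo n) (Fn_nRn n)).
rewrite (cocycle_add n n (unitary_nR n)) -nRnE -/U (adj_comp bU bp).
move=> /(congr1 (fun t : op => t \o (U \o phin n U))) h.
rewrite -[RHS]/(phin n U \o (U \o phin n U)) -h.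
rewrite -[RHS]/((U \o phin n U \o U) \o (adj (phin n U) \o (adj U \o U) \o phin n U)) U1.
by rewrite [adj (phin n U) \o idfun \o _]p1.
Qed.

End YangBaxter.

End Endo.

(** * Decorrelation and fixed points *)

Section Mixing.
Variables (K : realType) (d : nat) (G : cuntz_gns K d).
Implicit Types (c : K[i]).
Local Notation C := K[i].
Local Notation op := (op G).
Implicit Types (x y z w a b h : op).
Local Notation Om := (Omega G).
Local Notation phi := (phi G).
Local Notation phin n := (iter n phi).

Lemma cnm_small (z : C) (M : K) : (forall e : K, 0 < e -> complex.Re `|z| <= M * e) -> z = 0.
Proof.
move=> /le0_small h; apply/eqP; rewrite -normr_eq0 [`|z|]complex_ge0E //.
suff -> : complex.Re `|z| = 0 by [].
by apply/le_anti; rewrite h Re_norm_ge0.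
Qed.

Lemma Re_normB (z t : C) : complex.Re `|z - t| <= complex.Re `|z| + complex.Re `|t|.
Proof.
have := ler_normB z t.
by rewrite [`|z - t|]complex_ge0E // [`|z|]complex_ge0E // [`|t|]complex_ge0E // -rmorphD lecR.
Qed.

Lemma omega_le h : bounded_op h ->
  exists2 N : K, 0 <= N & forall a, complex.Re `|omega (h \o a)| <= N * nm (a Om).
Proof.
move=> bh; have [M M0 hM] := bop_le bh; exists (M * nm Om); first by rewrite mulr_ge0 ?nm_ge0.
move=> a; apply: le_trans (ip_le _ _) _; rewrite mulrAC ler_wpM2r ?nm_ge0 //=.
Qed.

Lemma omegaB x y : omega (x - y) = omega x - omega y.
Proof. exact: ipBl. Qed.

Lemma comp_Br h x y : bounded_op h -> h \o (x - y) = (h \o x) - (h \o y).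
Proof. by move=> bh; apply/funext => v; exact: (bopB bh). Qed.

(** Correlations are continuous for the convergence of values at [Om]. *)
Lemma omega_approx h a c : bounded_op h ->
  (forall e : K, 0 < e -> exists2 b, omega (h \o b) = c & nm (a Om - b Om) < e) ->
  omega (h \o a) = c.
Proof.
move=> bh hab; apply/eqP; rewrite -subr_eq0; apply/eqP.
have [N N0 hN] := omega_le bh; apply: (@cnm_small _ N) => e /hab[b <- hb].
rewrite -omegaB -comp_Br //; apply: le_trans (hN _) _.
by rewrite ler_wpM2l // ltW.
Qed.

(** The pairing [(y, x) |-> omega (y \o x)] identifies a level with its dual;
    the matrix units [munit nu mu] are dual to [munit mu nu] up to [d^n]. *)
Lemma Fn_dual n (psi : op -> C) :
  (forall c x y, Fn G n x -> Fn G n y -> psi (c *: x + y) = c * psi x + psi y) ->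
  exists2 y, Fn G n y & forall x, Fn G n x -> psi x = omega (y \o x).
Proof.
move=> psil.
have psi0 : psi 0 = 0.
  have := psil (-1) _ _ (Fn_id G n) (Fn_id G n).
  by rewrite scaleN1r addNr mulN1r addNr.
pose y : op := \sum_(mu : n.-tuple 'I_d) \sum_(nu : n.-tuple 'I_d)
  (d%:R ^+ n * psi (munit mu nu)) *: munit nu mu.
have Fy : Fn G n y.
  apply: Fn_sum => mu _; apply: Fn_sum => nu _; apply/FnE; apply: lspanZ.
  by apply: lspan_gen; exists nu, mu.
exists y => //; have by_ := bnd_Fn Fy; apply: Fn_ind.
- by rewrite psi0 comp0r // omega0.
- by move=> c x z hx hz ex ez; rewrite comp_linr // omega_lin psil // ex ez.
move=> al be /eqP hal /eqP hbe.
rewrite /y comp_suml omega_sum (bigD1 (Tuple hal)) //= comp_suml omega_sum (bigD1 (Tuple hbe)) //=.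
have E mu nu c : size mu = n -> size nu = n ->
    omega (c *: munit nu mu \o munit al be : op) = if (mu == al) && (nu == be) then c / d%:R ^+ n else 0.
  move=> hm hn; rewrite -[c *: _ \o _]/(c *: (munit nu mu \o munit al be)) omegaZ.
  rewrite munit_mul ?(eqP hal) //; case: eqP => _; last by rewrite omega0 mulr0.
  by rewrite omega_munit hn; case: eqP => _ //; rewrite mulr0.
rewrite E ?size_tuple ?(eqP hal) ?(eqP hbe) // !eqxx /=.
rewrite !big1 ?addr0.
- case: (posnP n) => [n0|n0]; first by rewrite n0 expr0 invr1 mul1r mulr1.
  have d0 : d%:R != 0 :> C.
    by rewrite pnatr_eq0; move: n0; rewrite -(eqP hal); case: (al) => // i _ _; case: (d) i => // -[].
  by rewrite mulrAC mulfV ?mul1r // expf_neq0.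
- move=> mu nmu; rewrite comp_suml omega_sum big1 // => nu _.
  rewrite E ?size_tuple //; case: eqP => //= e1.
  by move: nmu; rewrite -(inj_eq val_inj) /= e1 eqxx.
move=> nu nnu; rewrite E ?size_tuple ?(eqP hal) // eqxx /=; case: eqP => //= e1.
by move: nnu; rewrite -(inj_eq val_inj) /= e1 eqxx.
Qed.

(** The trace is faithful because [Om] is separating. *)
Lemma Fn_nondeg n z : Fn G n z -> (forall y, Fn G n y -> omega (y \o z) = 0) -> z = 0.
Proof.
move=> hz h; have bz := bnd_Fn hz; apply: Mvn_separating; first exact: Fn_Mvn hz.
apply: nm_eq0; have := h _ (Fn_adj hz); rewrite omega_sqE // -[0]/(0%:C%C) => -[] /eqP.
by rewrite sqrf_eq0 => /eqP.
Qed.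

Section Criterion.
Variables (R : op) (lam : op -> op).
Hypotheses (hR : Rmatrix R) (hl : endo R lam).

Let uR : unitary_op R := endo_unitary hl.
Let FR : Fn G 2 R. Proof. by have [[]] := hR. Qed.
Let bR : bounded_op R := unitary_bnd uR.

(** The condition [E_1 (R x adj R) = tau(x) 1] tested against the first level. It
    does not mention the conditional expectation, so it can be transported to
    the cabling powers, where no conditional expectations are given. *)
Definition decorrelates := forall x y, Fn G 1 x -> Fn G 1 y ->
  omega (y \o (R \o x \o adj R)) = omega y * omega x.

(** The first [n] of the [n+1] tensor factors of [y] do not meet the shifted
    element, and the last factor is handled by the hypothesis. *)
Lemma decorrelates_shift n y w : decorrelates -> Fn G n.+1 y -> Fn G 1 w ->
  omega (y \o phin n (R \o w \o adj R)) = omega y * omega w.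
Proof.
move=> dec hy hw; have bw := bnd_Fn hw.
have FR' : Fn G 2 (R \o w \o adj R).
  by apply: Fn_comp; [apply: Fn_comp => //; exact: Fn_S|exact: Fn_adj].
have bx := bnd_Fn FR'; have bpx := bnd_phin n bx.
rewrite -addn1 in hy; elim: (Fn_split hy) => [|c _ b [y0 [y1 [h0 h1 ->]]] _ IH].
  by rewrite comp0l omega0 mul0r.
rewrite comp_linl !omega_lin IH mulrDl; congr (_ + _); rewrite -mulrA; congr (_ * _).
rewrite -[X in omega X]/(y0 \o (phin n y1 \o phin n (R \o w \o adj R))).
rewrite -(phin_comp _ _ (bnd_Fn h1)) (omega_prod h0 (Fn_comp (Fn_S h1) FR')).
by rewrite dec // (omega_prod h0 h1) mulrA.
Qed.

(** [E_(n+1)(lambda(z (x) w)) = tau(w) lambda(z)]: on level [n+1] the implementing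
    unitary is that of level [n] times [phin n R], which commutes with [z]. *)
Lemma decorrelates_step n y z w : decorrelates -> Fn G n.+1 y -> Fn G n z -> Fn G 1 w ->
  omega (y \o lam (z \o phin n w)) = omega (y \o lam z) * omega w.
Proof.
move=> dec hy hz hw; have bz := bnd_Fn hz; have bw := bnd_Fn hw.
have hzw : Fn G n.+1 (z \o phin n w).
  by apply: Fn_comp; [exact: Fn_S|rewrite -addn1; exact: Fn_phin].
rewrite (endo_Fn hl hzw) (endo_Fn hl hz) cocycleS //.
set c := cocycle R n; have [bc c1 c2] : unitary_op c := unitary_cocycle n uR.
have Fc : Fn G n.+1 c := Fn_cocycle n uR FR.
have bp := bnd_phin n bR.
have Fx : Fn G 2 (R \o w \o adj R).
  by apply: Fn_comp; [apply: Fn_comp => //; exact: Fn_S|exact: Fn_adj].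
have Fpx : Fn G n.+2 (phin n (R \o w \o adj R)) by rewrite -addn2; exact: Fn_phin.
rewrite (adj_comp bc bp) -(phin_adj _ bR).
have -> : c \o phin n R \o (z \o phin n w) \o (phin n (adj R) \o adj c) =
    (c \o z \o phin n (R \o w \o adj R)) \o adj c.
  rewrite (phin_comp _ (adj R) (bnd_comp bR bw)) (phin_comp _ _ bR).
  rewrite -[LHS]/(c \o (phin n R \o z) \o (phin n w \o phin n (adj R) \o adj c)).
  by rewrite -(Fn_commute bR hz).
have Fy : Fn G n.+1 (adj c \o y \o c \o z).
  exact: (Fn_comp (Fn_comp (Fn_comp (Fn_adj Fc) hy) Fc) (Fn_S hz)).
have Fcz : Fn G n.+1 (c \o z) := Fn_comp Fc (Fn_S hz).
rewrite -[X in omega X]/((y \o c \o z \o phin n (R \o w \o adj R)) \o adj c).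
rewrite (@omegaC _ _ G n.+2); last 2 first.
- apply: Fn_comp Fpx; rewrite -[X in Fn G _ X]/(y \o (c \o z)).
  by apply: Fn_S; exact: Fn_comp.
- by apply: Fn_S; exact: Fn_adj.
rewrite -[X in omega X]/((adj c \o y \o c \o z) \o phin n (R \o w \o adj R)).
rewrite decorrelates_shift //; congr (_ * _).
rewrite -[X in _ = omega X]/((y \o (c \o z)) \o adj c) [RHS](@omegaC _ _ G n.+1) //.
  exact: Fn_comp.
exact: Fn_adj.
Qed.

(** The commutation rule [E_(n+1) lambda = lambda E_n] in dual form: the
    transpose of [lambda] for the trace pairing maps level [n+1] to level [n].
    By [decorrelates_step] the functional [omega (y \o lambda x)] ignores all
    factors of [x] after the [n]-th. *)
Lemma decorrelates_dual n y : decorrelates -> Fn G n.+1 y ->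
  exists2 y', Fn G n y' & forall m x, Fn G m x -> omega (y \o lam x) = omega (y' \o x).
Proof.
move=> dec hy; have by_ := bnd_Fn hy.
have psil m c x z : Fn G m x -> Fn G m z ->
    omega (y \o lam (c *: x + z)) = c * omega (y \o lam x) + omega (y \o lam z).
  move=> hx hz; rewrite (endo_lin hl); [|exact: Fn_Mvn hx|exact: Fn_Mvn hz].
  by rewrite comp_linr // omega_lin.
have [y' hy' ey'] := @Fn_dual n (fun x => omega (y \o lam x)) (@psil n).
have by' := bnd_Fn hy'.
exists y' => //.
have step k : forall x, Fn G (n + k) x -> omega (y \o lam x) = omega (y' \o x).
  elim: k => [|k IH] x; first by rewrite addn0; exact: ey'.
  rewrite addnS -addn1 => /[dup] Fx /Fn_split hx.
  suff [] : omega (y \o lam x) = omega (y' \o x) /\ Fn G (n + k + 1) x by [].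
  elim: hx => [|c _ b [z [w [hz hw ->]]] _ [e Fb]].
    split; last by apply/FnE; exact: lspan0.
    by rewrite (endo0 hl) !comp0r.
  have Fzw : Fn G (n + k + 1) (z \o phin (n + k) w).
    by apply: Fn_comp; [rewrite addn1; exact: Fn_S|exact: Fn_phin].
  split; last exact: Fn_lin.
  rewrite (@psil (n + k + 1)%N) // e comp_linr // omega_lin; congr (_ * _ + _).
  rewrite decorrelates_step //; last by apply: Fn_le hy; rewrite ltnS leq_addr.
  rewrite (IH _ hz) -[X in _ = omega X]/((y' \o z) \o phin (n + k) w) [RHS](omega_prod _ hw) //.
  by apply: Fn_comp => //; apply: Fn_le hy'; exact: leq_addr.
move=> m x hx; apply: (step m); apply: Fn_le hx; exact: leq_addl.
Qed.

Lemma decorrelates_dual_id n y y' : Fn G n.+1 y ->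
  (forall m x, Fn G m x -> omega (y \o lam x) = omega (y' \o x)) -> omega y = omega y'.
Proof. by move=> hy /(_ _ _ (Fn_id G 0)); rewrite (endo_id hl). Qed.

(** Both sides are continuous in [x Om], since [lambda] is isometric there. *)
Lemma decorrelates_dual_N n y y' x : Fn G n.+1 y -> Fn G n y' ->
  (forall m x, Fn G m x -> omega (y \o lam x) = omega (y' \o x)) ->
  Nvn G x -> omega (y \o lam x) = omega (y' \o x).
Proof.
move=> hy hy' e hx; have Mx := Nvn_Mvn hx.
have by_ := bnd_Fn hy; have by' := bnd_Fn hy'.
apply/eqP; rewrite -subr_eq0; apply/eqP.
have [N N0 hN] := omega_le by_; have [N' N'0 hN'] := omega_le by'.
apply: (@cnm_small _ (N + N')) => r r0; have [m [a [ha hxa]]] := Nvn_dense hx r0.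
have Ma := Fn_Mvn ha.
have -> : omega (y \o lam x) - omega (y' \o x) =
    omega (y \o (lam x - lam a)) - omega (y' \o (x - a)).
  by rewrite !comp_Br // !omegaB (e _ _ ha); ring.
have h1 := hN (lam x - lam a); have h2 := hN' (x - a).
have e1 : nm ((lam x - lam a) Om) < r by have := endo_nmB hl Mx Ma; rewrite !fctE => ->.
have e2 : nm ((x - a) Om) < r by rewrite !fctE.
have h3 := Re_normB (omega (y \o (lam x - lam a))) (omega (y' \o (x - a))).
have : N * nm ((lam x - lam a) Om) <= N * r by rewrite ler_wpM2l // ltW.
have : N' * nm ((x - a) Om) <= N' * r by rewrite ler_wpM2l // ltW.
lra.
Qed.

(** For a fixed point [x], the correlation with level [n+1] equals a
    correlation with level [n], and by induction one with level 0, that is with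
    scalars. So [x Om - omega(x) Om] is orthogonal to [F Om], in whose closure
    it lies. *)
Lemma decorrelates_fixed x : decorrelates -> Nvn G x -> lam x = x -> x = omega x *: idfun.
Proof.
move=> dec hx fx.
have indep n y : Fn G n y -> omega (y \o x) = omega y * omega x.
  elim: n y => [|n IH] y hy.
    have [c ->] := Fn0E hy.
    by rewrite -[_ \o x]/(c *: x) !omegaZ omega_id mulr1.
  have [y' hy' e] := decorrelates_dual dec hy.
  by rewrite -{1}fx (decorrelates_dual_N hy hy' e hx) IH // (decorrelates_dual_id hy e).
set c := omega x.
have hr : Nvn G ((- c) *: idfun + x) by apply: Nvn_lin => //; exact: Nvn_id.
suff /eqP : (- c) *: idfun + x = 0 by rewrite scaleNr addrC subr_eq0 => /eqP.
apply: Mvn_separating; first exact: Nvn_Mvn.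
set r := _ + x in hr *; set v := r Om.
suff h (e : K) : 0 < e -> nm v <= 1 * e by exact: nm_small h.
move=> e0; have [n [a [ha hva]]] := Nvn_dense hr e0.
have orth : ip G v (a Om) = 0.

  have -> : ip G v (a Om) = omega (adj a \o r).
    by rewrite /omega /= (ip_adjl (bnd_Fn ha)).
  have Fa := Fn_adj ha.
  rewrite /r comp_linr ?omega_lin; last exact: bnd_Fn Fa.
  by rewrite -[adj a \o idfun]/(adj a) (indep _ _ Fa) -/c mulNr mulrC addNr.
rewrite mul1r; have [->|v0] := eqVneq v 0; first by rewrite nm0 ltW.
have v1 : 0 < nm v.
  by rewrite lt_neqAle nm_ge0 andbT eq_sym; apply: contra_neq v0; exact: nm_eq0.
rewrite -(ler_pM2l v1); have := ip_le v (v - a Om); rewrite ipBr orth subr0 ip_nm.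
rewrite Re_normc ger0_norm ?exprn_ge0 ?nm_ge0 // => h.
apply: (@le_trans _ _ (nm v * nm (v - a Om))); first by rewrite -expr2.
by rewrite ler_wpM2l ?nm_ge0 // ltW.
Qed.

(** [E_n lambda^n = lambda^n E_0]: each application of [lambda] lowers the level
    of the test element by one. *)
Lemma decorrelates_iter n m x y : decorrelates -> Fn G n y -> Fn G m x ->
  omega (y \o iter n lam x) = omega y * omega x.
Proof.
move=> dec; elim: n m x y => [|n IH] m x y hy hx.
  have [c ->] := Fn0E hy.
  by rewrite -[_ \o _]/(c *: x) !omegaZ omega_id mulr1.
have [y' hy' e] := decorrelates_dual dec hy.
have Fi : Fn G (n + m) (iter n lam x).
  by elim: (n) => // k IHk; rewrite addSn iterS; exact: lam_Fn hR hl _ _ IHk.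
by rewrite iterS (e _ _ Fi) (IH _ _ _ hy' hx) (decorrelates_dual_id hy e).
Qed.

End Criterion.

End Mixing.

(** * The ergodic mean of an element of the first level *)

Section MeanErgodic.
Variables (K : realType) (d : nat) (G : cuntz_gns K d).
Implicit Types (c : K[i]).
Local Notation C := K[i].
Local Notation op := (op G).
Implicit Types (x y z w a b h : op).
Local Notation Om := (Omega G).
Local Notation phi := (phi G).
Local Notation phin n := (iter n phi).

Variables (R : op) (lam : op -> op).
Hypotheses (hR : Rmatrix R) (hl : endo R lam).

Let uR : unitary_op R := endo_unitary hl.
Let FR : Fn G 2 R. Proof. by have [[]] := hR. Qed.
Let bR : bounded_op R := unitary_bnd uR.

Lemma iter_lam1 k x : Fn G 1 x -> iter k lam x = nR k R \o x \o adj (nR k R).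
Proof. by move=> hx; rewrite (endo_Fn (iter_endo hR hl k) hx) cocycle1. Qed.

Lemma lam1 x : Fn G 1 x -> lam x = R \o x \o adj R.
Proof. by move=> hx; rewrite (endo_Fn hl hx) cocycle1. Qed.

Lemma Fn_iter_lam k n x : Fn G n x -> Fn G (k + n) (iter k lam x).
Proof. by move=> hx; elim: k => // k IH; rewrite addSn iterS; exact: lam_Fn hR hl _ _ IH. Qed.

(** For [x] in level 1, [lambda^(k+1)(x)] is the conjugate of [R x adj R] by
    [phi (nR k R)], which commutes with the first tensor factor and therefore
    drops out of the trace. *)
Lemma omega_iter_lam k x y : Fn G 1 x -> Fn G 1 y ->
  omega (y \o iter k.+1 lam x) = omega (y \o lam x).
Proof.
move=> hx hy; rewrite iter_lam1 // lam1 // (nRSr hl).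
have uW := unitary_nR hl k; have [bW _ _] := uW; have [bp p1 _] := unitary_phin 1 uW.
have FW : Fn G k.+2 (phi (nR k R)) := Fn_phi (Fn_nR hR k).
set P := phi (nR k R) in bp p1 FW *.
have FX : Fn G k.+2 (R \o x \o adj R).
  apply: (@Fn_le _ _ _ 2) => //.
  by apply: Fn_comp; [apply: Fn_comp => //; exact: Fn_S|exact: Fn_adj].
have hy' : Fn G k.+2 y by apply: (Fn_le _ hy).
rewrite (adj_comp bp bR).
rewrite -[X in omega X]/((y \o P \o (R \o x \o adj R)) \o adj P).
rewrite (omegaC (Fn_comp (Fn_comp hy' FW) FX) (Fn_adj FW)).
rewrite -[X in omega X]/(adj P \o (y \o P) \o (R \o x \o adj R)).
have -> : y \o P = P \o y by exact: (@Fn_commute _ _ _ 1 _ _ bW hy).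
by rewrite -[X in omega X]/((adj P \o P) \o (y \o (R \o x \o adj R))) p1.
Qed.

(** Midpoints replace general convex combinations, because midpoint-convexity
    is all that the minimization argument uses. *)
Inductive orbit_hull x : op -> Prop :=
| hull_iter : forall k, orbit_hull x (iter k.+1 lam x)
| hull_mid : forall a b, orbit_hull x a -> orbit_hull x b -> orbit_hull x (2^-1 *: (a + b)).

Lemma midE a b : 2^-1 *: (a + b) = 2^-1 *: a + (2^-1 *: b + 0).
Proof. by rewrite addr0 scalerDr. Qed.

Lemma hull_Fn x b : Fn G 1 x -> orbit_hull x b -> exists n, Fn G n b.
Proof.
move=> hx; elim=> [k|a b' _ [n hn] _ [m hm]]; first by exists (k.+1 + 1)%N; exact: Fn_iter_lam.
have h1 := Fn_le (leq_maxl n m) hn; have h2 := Fn_le (leq_maxr n m) hm.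
exists (maxn n m); rewrite midE; apply: Fn_lin => //; apply: Fn_lin => //.
by apply/FnE; exact: lspan0.
Qed.

Lemma hull_lam x b : Fn G 1 x -> orbit_hull x b -> orbit_hull x (lam b).
Proof.
move=> hx; elim=> [k|a b' ha IHa hb IHb]; first exact: (hull_iter x k.+1).
have [n hn] := hull_Fn hx ha; have [m hm] := hull_Fn hx hb.
have Ma := Fn_Mvn hn; have Mb := Fn_Mvn hm.
have M0 : Mvn G 0 by apply: (@Fn_Mvn _ _ _ 0); apply/FnE; exact: lspan0.
rewrite midE !(endo_lin hl) ?(endo0 hl) // -?midE; first exact: hull_mid.
exact: Mvn_lin.
Qed.

(** The orbit consists of unitary conjugates of [x]. *)
Lemma hull_bound x (M : K) b : Fn G 1 x -> 0 <= M -> (forall v, nm (x v) <= M * nm v) ->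
  orbit_hull x b -> forall v, nm (b v) <= M * nm v.
Proof.
move=> hx M0 hM; elim=> [k|a b' _ IHa _ IHb] v.
  have uW := unitary_nR hl k.+1; rewrite iter_lam1 //= (unitary_nm _ uW).
  by rewrite -(unitary_nm v (unitary_adj uW)).
rewrite !fctE nm_half; have := nmD (a v) (b' v); have := IHa v; have := IHb v; lra.
Qed.

Lemma half_double c : 2^-1 * (c + c) = c :> C.
Proof. by rewrite -mulr2n -[c *+ 2]mulr_natl mulKf // pnatr_eq0. Qed.

Lemma omega_mid h a b c : bounded_op h -> omega (h \o a) = c -> omega (h \o b) = c ->
  omega (h \o (2^-1 *: (a + b))) = c.
Proof.
move=> bh ha hb; rewrite midE !comp_linr // comp0r // !omega_lin omega0 addr0 ha hb.
by rewrite -mulrDr half_double.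
Qed.

Lemma hull_omega1 x y b : Fn G 1 x -> Fn G 1 y -> orbit_hull x b ->
  omega (y \o b) = omega (y \o lam x).
Proof.
move=> hx hy; elim=> [k|a b' _ IHa _ IHb]; first exact: omega_iter_lam.
by apply: omega_mid => //; exact: bnd_Fn hy.
Qed.

Lemma hull_omega_fixed x h b : Fn G 1 x -> Nvn G h -> lam h = h -> orbit_hull x b ->
  omega (h \o b) = omega (h \o x).
Proof.
move=> hx Nh fh; have Mh := Nvn_Mvn Nh; elim=> [k|a b' _ IHa _ IHb]; last first.
  by apply: omega_mid => //; exact: Nvn_bnd.
move: (k.+1) => {}k; elim: k => // k IH; rewrite iterS -{1}fh -(endo_comp hl) //; last first.
  exact: Fn_Mvn (Fn_iter_lam k hx).
rewrite (endo_omega hl) //; apply: Mvn_comp => //; exact: Fn_Mvn (Fn_iter_lam k hx).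
Qed.

(** Let [b] run through a minimizing sequence for the norm of [b Om] on the
    hull. It converges, and so does [lambda b], which is minimizing too, to the
    same vector [v]. Since the hull is uniformly bounded, [v = a Om] for some
    [a] in [N], and [a] is fixed because [Om] is separating. Correlations which
    are constant on the hull pass to [a]. *)
Lemma mean_ergodic x : Fn G 1 x -> exists a, [/\ N_fixed G lam a,
  forall h, N_fixed G lam h -> omega (h \o a) = omega (h \o x) &
  forall y, Fn G 1 y -> omega (y \o a) = omega (y \o lam x)].
Proof.
move=> hx; have bx := bnd_Fn hx; have [M M0 hM] := bop_le bx.
have [||m [v [_ _ hv]]] := @min_norm K G [set b Om | b in orbit_hull x].
- by exists (lam x Om); exists (lam x) => //; exact: (hull_iter x 0).
- move=> _ _ [a ha <-] [b hb <-]; exists (2^-1 *: (a + b)) => //; exact: hull_mid.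
have near (e : K) : 0 < e -> exists b, [/\ orbit_hull x b, nm (b Om - v) < e & nm (lam b Om - v) < e].
  move=> /hv[e' e'0 [[_ [b hb <-] hbm] hd]]; exists b; split=> //.
    by apply: hd => //; exists b.
  apply: hd; first by exists (lam b) => //; exact: hull_lam.
  by have [n hn] := hull_Fn hx hb; rewrite (endo_nm hl) //; exact: Fn_Mvn hn.
have [|a Na aOm] := @Nvn_limit K d G M v M0.
  move=> e /near[b [hb hbe _]]; exists b; split=> //; last exact: hull_bound hb.
  by have [n hn] := hull_Fn hx hb; exact: Fn_Nvn hn.
have Ma := Nvn_Mvn Na.
have fa : lam a = a.
  apply/eqP; rewrite -subr_eq0; apply/eqP; apply: Mvn_separating.
    by rewrite addrC -scaleN1r; apply: Mvn_lin => //; exact: endo_M hl _ Ma.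
  apply: (@nm_small _ _ _ 2) => e /near[b [hb h1 h2]].
  have [n hn] := hull_Fn hx hb; have Mb := Fn_Mvn hn.
  rewrite -[X in nm X]/(lam a Om - a Om) aOm.
  have := nmB_trans (lam b Om) (lam a Om) v; rewrite (endo_nmB hl) // aOm (nmBC v); lra.
have lim h c : bounded_op h -> (forall b, orbit_hull x b -> omega (h \o b) = c) ->
    omega (h \o a) = c.
  move=> bh hc; apply: omega_approx => // e /near[b [hb h1 _]].
  by exists b; [exact: hc|rewrite aOm nmBC].
exists a; split=> // [h [Nh fh]|y hy].
  by apply: lim => [|b hb]; [exact: Nvn_bnd|exact: hull_omega_fixed].
by apply: lim => [|b hb]; [exact: bnd_Fn hy|exact: hull_omega1].
Qed.

End MeanErgodic.

(** * Conditional expectations and ergodicity *)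

Section Equivalences.
Variables (K : realType) (d : nat) (G : cuntz_gns K d).
Implicit Types (c : K[i]).
Local Notation C := K[i].
Local Notation op := (op G).
Implicit Types (x y z w a b h : op).
Local Notation Om := (Omega G).
Local Notation phi := (phi G).
Local Notation phin n := (iter n phi).

Lemma cond_exp_omega (B : set op) (E : op -> op) x y : cond_exp G B E ->
  B `<=` Nvn G -> B idfun -> Nvn G x -> B y -> omega (y \o E x) = omega (y \o x).
Proof.
move=> hE BN B1 hx hy; have := ce_bimod hE hy hx B1 => h.
rewrite -[y \o E x]/(y \o E x \o idfun) -h.
exact: (ce_tau hE (Nvn_comp (BN _ hy) hx)).
Qed.

Variables (R : op) (lam : op -> op).
Hypotheses (hR : Rmatrix R) (hl : endo R lam).
Variables (E : nat -> op -> op) (HR : op -> op).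
Hypotheses (hE : forall n, cond_exp G (Fn G n) (E n)) (hH : cond_exp G (N_fixed G lam) HR).

Let uR : unitary_op R := endo_unitary hl.
Let FR : Fn G 2 R. Proof. by have [[]] := hR. Qed.
Let bR : bounded_op R := unitary_bnd uR.

Lemma E_omega n x y : Nvn G x -> Fn G n y -> omega (y \o E n x) = omega (y \o x).
Proof. by move=> hx hy; apply: cond_exp_omega (hE n) _ _ hx hy; [exact: Fn_Nvn|exact: Fn_id]. Qed.

(** [E n] is self-adjoint for the trace pairing, which is nondegenerate on the
    level. *)
Lemma E_eq n x z : Nvn G x -> Fn G n z ->
  (forall y, Fn G n y -> omega (y \o x) = omega (y \o z)) -> E n x = z.
Proof.
move=> hx hz h; apply/eqP; rewrite -subr_eq0; apply/eqP; apply: (@Fn_nondeg _ _ _ n).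
  rewrite addrC -scaleN1r; apply: Fn_lin => //; exact: ce_range (hE n) _ hx.
move=> y hy; rewrite comp_Br; last exact: bnd_Fn hy.
by rewrite omegaB E_omega // h // subrr.
Qed.

Lemma Fn_scalar n c : Fn G n (c *: idfun).
Proof. by rewrite -[_ *: _]addr0; apply: Fn_lin; [exact: Fn_id|apply/FnE; exact: lspan0]. Qed.

Lemma comp_scalar y c : bounded_op y -> y \o (c *: idfun) = c *: y.
Proof. by move=> by_; apply/funext => v; rewrite /= !fctE (bopZ by_). Qed.

Lemma E0E x : Nvn G x -> E 0 x = omega x *: idfun.
Proof.
move=> hx; apply: E_eq => //; first exact: Fn_scalar.
move=> y /Fn0E[c ->]; rewrite comp_scalar; last first.
  by rewrite -[_ *: _]addr0; apply: bnd_lin; [exact: bnd_id|exact: bnd0].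
by rewrite -[_ \o x]/(c *: x) !omegaZ omega_id mulr1 mulrC.
Qed.

Lemma conj_Fn n k x v : Fn G k x -> Fn G n v -> (k <= n)%N -> Fn G n (v \o x \o adj v).
Proof.
by move=> hx hv kn; apply: Fn_comp; [apply: Fn_comp => //; exact: Fn_le hx|exact: Fn_adj].
Qed.

Lemma decorrelates_E1 : decorrelates R <->
  forall x, Fn G 1 x -> E 1 (R \o x \o adj R) = tau x *: idfun.
Proof.
split=> [h x hx|h x y hx hy].
  apply: E_eq; first exact: Fn_Nvn (conj_Fn hx FR isT).
    exact: Fn_scalar.
  move=> y hy; rewrite h // comp_scalar; last exact: bnd_Fn hy.
  by rewrite omegaZ mulrC.
rewrite mulrC -(E_omega (Fn_Nvn (conj_Fn hx FR isT)) hy) h // comp_scalar; last exact: bnd_Fn hy.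
exact: omegaZ.
Qed.

Lemma E_split m z w : Fn G m z -> Fn G 1 w -> E m (z \o phin m w) = omega w *: z.
Proof.
move=> hz hw; have Fp := Fn_phin m hw; have Fz : Fn G (m + 1) z by apply: Fn_le hz; exact: leq_addr.
apply: E_eq; first exact: Fn_Nvn (Fn_comp Fz Fp).
  by rewrite -[_ *: _]addr0; apply: Fn_lin => //; apply/FnE; exact: lspan0.
move=> y hy; have by_ := bnd_Fn hy.
rewrite -[y \o (z \o _)]/((y \o z) \o phin m w) (omega_prod (Fn_comp hy hz) hw).
rewrite mulrC -omegaZ; congr omega; apply/funext => v; rewrite /= !fctE /=.
by rewrite (bopZ by_).
Qed.

(** Write [x = z (x) w] with [w] in the last factor; [phin m R] commutes with
    [z], and [decorrelates_shift] integrates the conjugate of [w] out. *)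
Lemma decorrelates_En : decorrelates R -> forall n : nat, (1 <= n)%N -> forall x, Fn G n x ->
  E n (phin n.-1 R \o x \o phin n.-1 (adj R)) = E n.-1 x.
Proof.
move=> dec [//|m] _ x hx /=.
have Fp : Fn G m.+2 (phin m R) by rewrite -addn2; exact: Fn_phin.
have bp := bnd_phin m bR; rewrite (phin_adj _ bR).
have Ex := ce_range (hE m) (Fn_Nvn hx).
apply: E_eq; first exact: Fn_Nvn (conj_Fn hx Fp (leqnSn _)).
  exact: Fn_S.
move=> y hy; have by_ := bnd_Fn hy.
have Fx := hx; rewrite -addn1 in hx.
suff [] : omega (y \o (phin m R \o x \o adj (phin m R))) = omega (y \o E m x) /\ Fn G m.+1 x by [].
elim: (Fn_split hx) => [|c _ b [z [w [hz hw ->]]] _ [e Fb]].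
  have E00 : E m 0 = 0.
    apply: E_eq => //; [apply: (@Fn_Nvn _ _ _ 0)| ]; apply/FnE; exact: lspan0.
  by rewrite E00 (comp0r bp) comp0l; split=> //; apply/FnE; exact: lspan0.
have Fzw : Fn G m.+1 (z \o phin m w).
  by apply: Fn_comp; [exact: Fn_S|rewrite -addn1; exact: Fn_phin].
split; last exact: Fn_lin.
rewrite (ce_lin (hE m)); [|exact: Fn_Nvn Fzw|exact: Fn_Nvn Fb].
rewrite (comp_linr _ _ _ bp) comp_linl !(comp_linr _ _ _ by_) !omega_lin e; congr (_ * _ + _).
rewrite E_split //; have bz := bnd_Fn hz; have bw := bnd_Fn hw.
have -> : phin m R \o (z \o phin m w) \o adj (phin m R) = z \o phin m (R \o w \o adj R).
  rewrite (phin_comp _ (adj R) (bnd_comp bR bw)) (phin_comp _ _ bR) (phin_adj _ bR).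
  rewrite -[LHS]/((phin m R \o z) \o phin m w \o adj (phin m R)).
  by rewrite -(Fn_commute bR hz).
rewrite -[X in omega X = _]/((y \o z) \o phin m (R \o w \o adj R)).
rewrite (decorrelates_shift hR dec (Fn_comp hy (Fn_S hz)) hw) mulrC -omegaZ; congr omega.
by apply/funext => v; rewrite /= !fctE /= (bopZ by_).
Qed.

Lemma N_fixed_scalar c : N_fixed G lam (c *: idfun).
Proof.
have F0 : Fn G 0 (0 : op) by apply/FnE; exact: lspan0.
split; first exact: Fn_Nvn (Fn_scalar 0 c).
rewrite -[_ *: _]addr0 (endo_lin hl) ?(endo_id hl) ?(endo0 hl) //; [exact: Fn_Mvn (Fn_id G 0)|exact: Fn_Mvn F0].
Qed.

Lemma decorrelates_ergodic : decorrelates R -> ergodic lam.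
Proof.
move=> dec; apply/seteqP; split=> [x [hx fx]|_ [c ->]]; last exact: N_fixed_scalar.
by exists (omega x); exact: decorrelates_fixed hR hl _ dec hx fx.
Qed.

Lemma ergodic_HR : ergodic lam -> forall x, Fn G 1 x -> HR x = tau x *: idfun.
Proof.
move=> erg x hx; have Nx := Fn_Nvn hx.
have : N_fixed G lam (HR x) := ce_range hH Nx.
rewrite erg => -[c hc]; have := ce_tau hH Nx.
by rewrite hc /tau omegaZ omega_id mulr1 => ->.
Qed.

(** [HR x] and the ergodic mean of [x] are fixed points with the same
    correlations with all fixed points, hence equal. The correlations of the
    mean with level 1 are those of [R x adj R]. *)
Lemma HR_decorrelates : (forall x, Fn G 1 x -> HR x = tau x *: idfun) -> decorrelates R.
Proof.
move=> hHR x y hx hy; have Nx := Fn_Nvn hx.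
have [a [[Na fa] ha hay]] := mean_ergodic hR hl hx.
have [NH fH] : N_fixed G lam (HR x) := ce_range hH Nx.
(* the test element is the adjoint of the difference itself *)
have E1 : HR x = a.
  apply/eqP; rewrite -subr_eq0; apply/eqP; set r := _ - _.
  have Nr : Nvn G r by rewrite /r addrC -scaleN1r; apply: Nvn_lin.
  have Mr := Nvn_Mvn Nr; have br := Mvn_bnd Mr.
  have fr : lam r = r.
    rewrite /r addrC -scaleN1r (endo_lin hl) ?fa ?fH //; exact: Nvn_Mvn.
  have hr : N_fixed G lam (adj r).
    by split; [exact: Nvn_adj|rewrite (endo_adj hl) // fr].
  have := ha _ hr.
  rewrite -(@cond_exp_omega _ _ x (adj r) hH) //; last first.
  - by split; [exact: Nvn_id|exact: endo_id hl].
  - by move=> z [].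
  move=> /esym/eqP; rewrite -subr_eq0 -omegaB -comp_Br; last exact: bnd_adj.
  rewrite -/r omega_sqE // => /eqP h; apply: Mvn_separating => //; apply: nm_eq0.
  by move: h; rewrite -[0]/(0%:C%C) => -[] /eqP; rewrite sqrf_eq0 => /eqP.
rewrite -(lam1 hl hx) -hay // -E1 hHR // comp_scalar; last exact: bnd_Fn hy.
by rewrite omegaZ mulrC.
Qed.

End Equivalences.

(** * Cabling powers *)

Section Cabling.
Variables (K : realType) (d n : nat) (G : cuntz_gns K d) (G' : cuntz_gns K (d ^ n)).
Variable c : op G -> op G'.
Hypothesis hc : grouping G G' c.
Implicit Types (x y : op G).
Local Notation C := K[i].

Lemma block_inj : injective (@block d n).
Proof. by move=> s t /cast_ord_inj /enum_rank_inj. Qed.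

Lemma block_bij : bijective (@block d n).
Proof.
apply: inj_card_bij; first exact: block_inj.
by rewrite card_ord card_word.
Qed.

Lemma blocks_of (s : seq 'I_d) k : size s = (n * k)%N ->
  exists2 B : seq (n.-tuple 'I_d), size B = k & flatten (map val B) = s.
Proof.
elim: k s => [|k IH] s hs.
  by exists [::] => //; apply/esym/size0nil; rewrite hs muln0.
have h1 : size (take n s) == n by rewrite size_takel // hs mulnS leq_addr.
have [|B hB eB] := IH (drop n s); first by rewrite size_drop hs mulnS addKn.
by exists (Tuple h1 :: B); rewrite /= ?hB // eB cat_take_drop.
Qed.

Lemma grp_lin a x y : Nvn G x -> Nvn G y -> c (a *: x + y) = a *: c x + c y.
Proof. exact: (hom_lin (grp_hom hc)). Qed.

Lemma grp_comp x y : Nvn G x -> Nvn G y -> c (x \o y) = c x \o c y.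
Proof. exact: (hom_mul (grp_hom hc)). Qed.

Lemma grp_adj x : Nvn G x -> c (adj x) = adj (c x).
Proof. exact: (hom_adj (grp_hom hc)). Qed.

Lemma grp_id : c idfun = idfun.
Proof. exact: (hom_one (grp_hom hc)). Qed.

Lemma grp0 : c 0 = 0.
Proof.
have h := Nvn_id G; have := grp_lin (-1) h h.
by rewrite !scaleN1r !addNr.
Qed.

Lemma grp_sum (I : Type) (r : seq I) (f : I -> op G) m : (forall i, Fn G m (f i)) ->
  c (\sum_(i <- r) f i) = \sum_(i <- r) c (f i).
Proof.
move=> hf; elim: r => [|i r IH]; first by rewrite !big_nil grp0.
rewrite !big_cons -IH -[f i]scale1r grp_lin ?scale1r //; first exact: Fn_Nvn (hf i).
by apply: (@Fn_Nvn _ _ _ m); apply: Fn_sum.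
Qed.

Lemma grp_munit mu nu (B B' : seq (n.-tuple 'I_d)) : size B = size B' ->
  flatten (map val B) = mu -> flatten (map val B') = nu ->
  c (munit mu nu) = munit (map (@block d n) B) (map (@block d n) B').
Proof. by move=> hB <- <-; exact: (grp_units hc hB). Qed.

Lemma grp_Fn k x : Fn G (n * k) x -> Fn G' k (c x).
Proof.
move: x; apply: Fn_ind.
- by rewrite grp0; apply/FnE; exact: lspan0.
- by move=> a x y hx hy h h'; rewrite grp_lin; [exact: Fn_lin|exact: Fn_Nvn hx|exact: Fn_Nvn hy].
move=> mu nu /blocks_of[B hB eB] /blocks_of[B' hB' eB'].
by rewrite (grp_munit _ eB eB') ?hB ?hB' //; apply: munit_Fn; rewrite size_map.
Qed.

Lemma grp_omega k x : Fn G (n * k) x -> omega (c x) = omega x.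
Proof.
move: x; apply: Fn_ind.
- by rewrite grp0 !omega0.
- move=> a x y hx hy h h'; rewrite grp_lin ?omega_lin ?h ?h' //; [exact: Fn_Nvn hx|exact: Fn_Nvn hy].
move=> mu nu hmu hnu; have [B hB eB] := blocks_of hmu; have [B' hB' eB'] := blocks_of hnu.
rewrite omega_munit; have [e|ne] := eqVneq mu nu.
  rewrite -e (grp_munit _ eB eB) // omega_munit eqxx size_map hB hmu.
  by rewrite natrX -exprM.
rewrite (grp_munit _ eB eB') ?hB ?hB' // omega_munit (inj_eq (inj_map block_inj)).
by case: eqP => // eBB; move: ne; rewrite -eB -eB' eBB eqxx.
Qed.

(** The sum is a left unit for the matrix units of level [n], hence for the
    identity operator, which belongs to this level. *)
Lemma sum_munit_id : \sum_(t : n.-tuple 'I_d) munit t t = idfun :> op G.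
Proof.
set P := \sum_t _; suff h : forall x, Fn G n x -> P \o x = x by exact: (h _ (Fn_id G n)).
have bP : bounded_op P by apply: bnd_sum => t _; exact: bnd_munit.
apply: Fn_ind.
- by rewrite comp0r.
- by move=> a x y _ _ hx hy; rewrite comp_linr // hx hy.
move=> mu nu /eqP hmu hnu; rewrite /P comp_suml (bigD1 (Tuple hmu)) //=.
rewrite munit_mul // eqxx big1 ?addr0 // => t nt.
rewrite munit_mul ?size_tuple ?(eqP hmu) //; case: eqP => // e.
by move: nt; rewrite -(inj_eq val_inj) /= e eqxx.
Qed.

Lemma phin_munit mu nu :
  iter n (phi G) (munit mu nu) = \sum_(t : n.-tuple 'I_d) munit (t ++ mu) (t ++ nu).
Proof.
rewrite -[LHS]/(idfun \o iter n (phi G) (munit mu nu)) -sum_munit_id comp_suml.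
by apply: eq_bigr => t _; rewrite munit_phin // size_tuple.
Qed.

(** Both sides are sums over the words of length [n], read as letters of the
    large alphabet on the left and as words of the small one on the right. *)
Lemma grp_phi k x : Fn G (n * k) x -> phi G' (c x) = c (iter n (phi G) x).
Proof.
move: x; apply: Fn_ind.
- by rewrite grp0 phin0 grp0 phi0.
- move=> a x y hx hy h h'; rewrite grp_lin; [|exact: Fn_Nvn hx|exact: Fn_Nvn hy].
  rewrite phi_lin phin_lin grp_lin ?h ?h' //; [exact: Fn_Nvn (Fn_phin n hx)|exact: Fn_Nvn (Fn_phin n hy)].
move=> mu nu hmu hnu; have [B hB eB] := blocks_of hmu; have [B' hB' eB'] := blocks_of hnu.
rewrite (grp_munit _ eB eB') ?hB ?hB' // phi_munit phin_munit.
rewrite (@grp_sum _ _ _ (n + n * k)%N); last first.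
  by move=> t; apply: munit_Fn; rewrite size_cat size_tuple ?hmu ?hnu.
rewrite (reindex _ (onW_bij _ block_bij)) /=; apply: eq_bigr => t _.
rewrite (@grp_munit _ _ (t :: B) (t :: B')) //= ?hB ?hB' ?eB ?eB' //.
Qed.

Lemma grp_onto1 z : Fn G' 1 z -> exists2 x, Fn G n x & c x = z.
Proof.
have F0 : Fn G n (0 : op G) by apply/FnE; exact: lspan0.
move: z; apply: Fn_ind.
- by exists 0 => //; exact: grp0.
- move=> a _ _ _ _ [x hx <-] [y hy <-]; exists (a *: x + y); first exact: Fn_lin.
  by rewrite grp_lin //; [exact: Fn_Nvn hx|exact: Fn_Nvn hy].
have [g bg gb] := block_bij.
move=> [|i [|? ?]] // [|j [|? ?]] // _ _; exists (munit (g i) (g j)).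
  by apply: munit_Fn; rewrite size_tuple.
by rewrite (@grp_munit _ _ [:: g i] [:: g j]) //= ?gb ?cats0.
Qed.

Variables (R : op G) (lam : op G -> op G).
Hypotheses (hR : Rmatrix R) (hl : endo R lam).
Local Notation U := (nRn n R).

Let FU : Fn G (n * 2) U. Proof. by rewrite muln2 -addnn; exact: (Fn_nRn hR hl). Qed.
Let NU : Nvn G U := Fn_Nvn FU.
Let NUa : Nvn G (adj U) := Nvn_adj NU.

Lemma cabling_unitary : unitary_op (c U).
Proof.
have [_ h h'] := unitary_nRn hl n; split; first exact: bnd_Fn (grp_Fn FU).
  by rewrite -grp_adj // -grp_comp // h grp_id.
by rewrite -grp_adj // -grp_comp // h' grp_id.
Qed.

Lemma cabling_Rmatrix : Rmatrix (c U).
Proof.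
have [_ h h'] := cabling_unitary; split; first by split=> //; exact: grp_Fn.
have Np : Nvn G (iter n (phi G) U) := Fn_Nvn (Fn_phin n FU).
rewrite (grp_phi FU) -!grp_comp //; [|exact: Nvn_comp..].
by rewrite (nRn_ybe hR hl).
Qed.

(** On the first block conjugation by [nRn n R] is [lambda_R^n], so that the
    claim is [decorrelates_iter]. *)
Lemma cabling_decorrelates : decorrelates R -> decorrelates (c U).
Proof.
move=> dec _ _ /grp_onto1[x hx <-] /grp_onto1[y hy <-].
have Nx := Fn_Nvn hx; have Ny := Fn_Nvn hy.
have Nz : Nvn G (U \o x \o adj U) by apply: Nvn_comp => //; exact: Nvn_comp.
have hx2 : Fn G (n * 2) x by apply: Fn_le hx; exact: leq_pmulr.
have hy2 : Fn G (n * 2) y by apply: Fn_le hy; exact: leq_pmulr.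
have hz2 : Fn G (n * 2) (y \o (U \o x \o adj U)).
  by apply: (Fn_comp hy2); apply: Fn_comp (Fn_adj FU); exact: Fn_comp.
rewrite -grp_adj // -!grp_comp //; last exact: Nvn_comp.
rewrite (grp_omega hz2) (grp_omega hx2) (grp_omega hy2).
by rewrite -(iter_lam_nRn hR hl hx); exact: (decorrelates_iter hR hl dec hy hx).
Qed.

End Cabling.

Theorem theorem7p5 (K : realType) (d : nat) (hd : (2 <= d)%N)
    (G : cuntz_gns K d) (R : op G) (hR : Rmatrix R)
    (lam : op G -> op G) (hlam : lambda_ext R lam)
    (E : nat -> op G -> op G) (hE : forall n : nat, cond_exp G (Fn G n) (E n))
    (HR : op G -> op G) (hHR : cond_exp G (N_fixed G lam) HR) :
  [<-> forall x, Fn G 1%N x -> E 1%N (R \o x \o adj R) = tau x *: idfun;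
       forall n : nat, (1 <= n)%N -> forall x, Fn G n x ->
         E n (iter n.-1 (phi G) R \o x \o iter n.-1 (phi G) (adj R))
         = E n.-1 x;
       forall x, Fn G 1%N x -> HR x = tau x *: idfun;
       ergodic lam]
  /\
  (ergodic lam ->
   forall n : nat, (1 <= n)%N ->
   forall (G' : cuntz_gns K (d ^ n)) (c : op G -> op G'), grouping G G' c ->
     Rmatrix (c (nRn n R)) /\
     forall lam' : op G' -> op G', lambda_ext (c (nRn n R)) lam' -> ergodic lam').
Proof.
have uR : unitary_op R.
  by have [[FR h h'] _] := hR; split=> //; exact: bnd_Fn FR.
have hl : endo R lam := lambda_endo uR hlam.
have decE := decorrelates_E1 hR hE.
have erg_dec : ergodic lam -> decorrelates R.
  by move=> /(ergodic_HR hHR); exact: (HR_decorrelates hR hl hHR).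
split.
  tfae.
  - by move=> /decE; exact: (decorrelates_En hR hl hE).
  - move=> h; apply: (ergodic_HR hHR); apply: (decorrelates_ergodic hR hl); apply/decE.
    by move=> x hx; have := h 1%N isT x hx; rewrite (E0E hE) //; exact: Fn_Nvn hx.
  - by move=> /(HR_decorrelates hR hl hHR); exact: (decorrelates_ergodic hR hl).
  - by move=> /erg_dec /decE.
move=> /erg_dec dec n n1 G' c hc; split; first exact: (cabling_Rmatrix hc hR hl).
move=> lam' hlam'; apply: (decorrelates_ergodic (cabling_Rmatrix hc hR hl)).
  exact: lambda_endo (cabling_unitary hc hR hl) hlam'.
exact: (cabling_decorrelates hc hR hl).
Qed.
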